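(* Let $X$ be a non-reflexive right $M$-embedded operator space and let $Y$ be a closed subspace of $X$. Then $\mathrm{dens}(Y)=\mathrm{dens}(Y^* )$. In particular, separable subspaces of $X$ have a separable dual. Consequently $X$ is an Asplund space, and $X^*$ has the Radon–Nikodým property.
   Context: For an operator space $X$, the bidual $X^{**}$ carries its standard dual operator space structure and $i_X:X\to X^{**}$ is the canonical complete isometry. $C_2(X)$ denotes the space of columns of length 2 over $X$, as a subspace of $M_2(X)$. A complete left $M$-projection on an operator space $X$ is a linear idempotent $P:X\to X$ such that the map $X\to C_2(X)$, $x\mapsto \begin{bmatrix}P(x)\\ x-P(x)\end{bmatrix}$, is a complete isometry. A right $M$-summand is the range of a complete left $M$-projection. A closed subspace $J\subset X$ is a right $M$-ideal of $X$ if $J^{\perp\perp}$ is a right $M$-summand of $X^{**}$. An operator space $X$ is right $M$-embedded if $i_X(X)$ is a right $M$-ideal of $X^{**}$. The density character $\mathrm{dens}(X)$ is the least cardinal $m$ such that $X$ has a norm-dense subset of cardinality $m$. A Banach space is an Asplund space if every separable subspace of it has a separable dual. *)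

(* Defs.v *)
From HB Require Import structures.
From mathcomp Require Import all_boot all_order all_algebra.
From mathcomp Require Import complex.
From mathcomp Require Import all_classical all_reals all_analysis.
From mathcomp Require Import ring lra.

Set Implicit Arguments.
Unset Strict Implicit.
Unset Printing Implicit Defensive.

Import Order.TTheory GRing.Theory Num.Theory.
Import numFieldNormedType.Exports.

Local Open Scope classical_set_scope.
Local Open Scope ring_scope.
Local Open Scope complex_scope.

(* Norms over [R[i]] take values in [R[i]]; [rnorm] is the norm as a real. *)
Definition rnorm (R : realType) (V : normedModType R[i]) (x : V) : R :=
  complex.Re `|x|.

Section RNorm.
Context (R : realType) (V : normedModType R[i]).
Implicit Types x y : V.

Lemma rnormE x : `|x| = (rnorm x)%:C.
Proof. by rewrite /rnorm RRe_real // normr_real. Qed.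

Lemma rnorm_ge0 x : 0 <= rnorm x.
Proof. by have := normr_ge0 x; rewrite rnormE ler0c. Qed.

Lemma rnormD x y : rnorm (x + y) <= rnorm x + rnorm y.
Proof. by rewrite -lecR rmorphD /= -!rnormE ler_normD. Qed.

Lemma rnorm0 : rnorm (0 : V) = 0.
Proof. by apply: complexI; rewrite -rnormE normr0. Qed.

Lemma rnorm_eq0 x : rnorm x = 0 -> x = 0.
Proof. by move=> x0; apply/eqP; rewrite -normr_eq0 rnormE x0. Qed.
Lemma rnorm_sum (I : Type) (r : seq I) (P : pred I) (F : I -> V) :
  rnorm (\sum_(i <- r | P i) F i) <= \sum_(i <- r | P i) rnorm (F i).
Proof.
elim/big_ind2 : _ => [|x1 x2 y1 y2 h1 h2|//]; first by rewrite rnorm0.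
by rewrite (le_trans (rnormD _ _))// lerD.
Qed.

End RNorm.
Lemma rnormZ (R : realType) (V : normedModType R[i]) (a : R[i]) (x : V) :
  rnorm (a *: x) = rnorm (a : R[i]^o) * rnorm x.
Proof. by apply: complexI; rewrite rmorphM /= -!rnormE normrZ. Qed.

Section Dual.
Context (R : realType) (X : normedModType R[i]).

Definition dual_pred : {pred X -> R[i]^o} :=
  fun f => `[< linear f /\ continuous f >].

Record dual := Dual { dual_fun :> X -> R[i]^o ; _ : dual_fun \in dual_pred }.

HB.instance Definition _ := [isSub for dual_fun].
HB.instance Definition _ := [Choice of dual by <:].

Lemma dual_submod_closed : submod_closed dual_pred.
Proof.
split; first by apply/asboolP; split=> [a x y|x];
  [rewrite scaler0 addr0|exact: cvg_cst].
move=> a f g /asboolP[fl fc] /asboolP[gl gc]; apply/asboolP; split=> [b x y|x].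
  by rewrite !fctE fl gl !scalerDr addrACA !scalerA mulrC.
by apply: cvgD; [apply: cvgZr; exact: fc|exact: gc].
Qed.

HB.instance Definition _ :=
  GRing.isSubmodClosed.Build R[i] (X -> R[i]^o) dual_pred dual_submod_closed.
HB.instance Definition _ := [SubChoice_isSubLmodule of dual by <:].

Lemma dual_linear (f : dual) : linear f.
Proof. by case: f => f /= /asboolP[]. Qed.

Lemma dual_continuous (f : dual) : continuous f.
Proof. by case: f => f /= /asboolP[]. Qed.

HB.instance Definition _ (f : dual) :=
  GRing.isLinear.Build R[i] X R[i]^o _ f (@dual_linear f).

Definition dnorm (f : dual) : R :=
  sup [set rnorm (f x) | x in [set x | rnorm x <= 1]].

Lemma dual_bounded (f : dual) :
  exists2 M : R, 0 < M & forall x, rnorm (f x) <= M * rnorm x.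
Proof.
have /linear_boundedP : bounded_near f (nbhs (0 : X)).
  exact/linear_bounded_continuous/dual_continuous.
move=> /pinfty_ex_gt0[M M0 fM]; exists (complex.Re M).
  by move: M0; rewrite ltcE => /andP[].
move=> x; have := fM x; rewrite -lecR rmorphM/= -!rnormE RRe_real//.
exact: gtr0_real.
Qed.

Lemma dnorm_has_sup (f : dual) :
  has_sup [set rnorm (f x) | x in [set x | rnorm x <= 1]].
Proof.
split; first by exists (rnorm (f 0)), 0 => //=; rewrite rnorm0.
have [M M0 fM] := dual_bounded f; exists M => _ [x /= x1 <-].
by rewrite (le_trans (fM x))// ler_piMr// ltW.
Qed.

Lemma dnormP (f : dual) x : rnorm (f x) <= dnorm f * rnorm x.
Proof.
have [->|x0] := eqVneq x 0; first by rewrite linear0 !rnorm0 mulr0.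
have nx0 : 0 < rnorm x.
  by rewrite lt_neqAle rnorm_ge0 eq_sym andbT; apply: contra x0 => /eqP/rnorm_eq0 ->.
rewrite -ler_pdivrMr//; apply: ub_le_sup; first by have [] := dnorm_has_sup f.
have nV : rnorm ((rnorm x)^-1%:C : R[i]^o) = (rnorm x)^-1.
  by rewrite /rnorm ger0_norm// lecR invr_ge0 rnorm_ge0.
exists ((rnorm x)^-1%:C *: x) => /=.
  by rewrite rnormZ nV mulVf// gt_eqF.
by rewrite linearZ/= rnormZ nV mulrC.
Qed.

Lemma dnorm_le (f : dual) (c : R) : 0 <= c ->
  (forall x, rnorm (f x) <= c * rnorm x) -> dnorm f <= c.
Proof.
move=> c0 fc; apply: ge_sup; first by have [] := dnorm_has_sup f.
by move=> _ [x /= x1 <-]; rewrite (le_trans (fc x))// ler_piMr.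
Qed.

Lemma dnorm_ge0 (f : dual) : 0 <= dnorm f.
Proof.
apply: ub_le_sup; first by have [] := dnorm_has_sup f.
by exists 0 => /=; rewrite ?linear0 rnorm0.
Qed.

Lemma dualP (f g : dual) : (forall x, f x = g x) -> f = g.
Proof. by move=> fg; apply/val_inj/funext. Qed.

Let dual_ler_normD (f g : dual) :
  (dnorm (f + g))%:C <= (dnorm f)%:C + (dnorm g)%:C.
Proof.
rewrite -rmorphD lecR; apply: dnorm_le => [|x]; first by rewrite addr_ge0 ?dnorm_ge0.
by rewrite (le_trans (rnormD _ _))// mulrDl lerD// dnormP.
Qed.

Let dual_normrZ (a : R[i]) (f : dual) : (dnorm (a *: f))%:C = `|a| * (dnorm f)%:C.
Proof.
have le b h : dnorm (b *: h) <= rnorm (b : R[i]^o) * dnorm h.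
  apply: dnorm_le => [|x]; first by rewrite mulr_ge0 ?dnorm_ge0 ?rnorm_ge0.
  by rewrite rnormZ -mulrA ler_wpM2l ?rnorm_ge0 ?dnormP.
rewrite (rnormE (a : R[i]^o)) -rmorphM/=; congr (_%:C).
apply/eqP; rewrite eq_le le/=.
have [->|a0] := eqVneq a 0; first by rewrite rnorm0 mul0r dnorm_ge0.
have a0' : 0 < rnorm (a : R[i]^o).
  by rewrite lt_neqAle rnorm_ge0 eq_sym andbT; apply: contra a0 => /eqP/rnorm_eq0 ->.
rewrite mulrC -ler_pdivlMr// mulrC.
have := le a^-1 (a *: f); rewrite scalerA mulVf// scale1r.
by have -> : rnorm (a^-1 : R[i]^o) = (rnorm (a : R[i]^o))^-1
  by apply: complexI; rewrite -rnormE normfV fmorphV/= -rnormE.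
Qed.

Let dual_norm0_eq0 (f : dual) : (dnorm f)%:C = 0 -> f = 0.
Proof.
move=> [f0]; apply: dualP => x; apply: rnorm_eq0; apply/eqP.
by rewrite eq_le rnorm_ge0 andbT (le_trans (dnormP _ _))// f0 mul0r.
Qed.

HB.instance Definition _ := Lmodule_isNormed.Build R[i] dual
  dual_ler_normD dual_normrZ dual_norm0_eq0.

Lemma dual_rnormE (f : dual) : rnorm f = dnorm f.
Proof. by []. Qed.

End Dual.

Section L2.
Context (R : realType).
Local Notation C := R[i]^o.

Lemma rnormM (a b : R[i]) : rnorm (a * b : C) = rnorm (a : C) * rnorm (b : C).
Proof. exact: (rnormZ (V := R[i]^o)). Qed.

Lemma rnormcJ (a : R[i]) : rnorm ((a^*)%C : C) = rnorm (a : C).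
Proof. by rewrite /rnorm [in LHS]normcJ. Qed.

Definition l2norm (I : finType) (v : I -> C) : R :=
  Num.sqrt (\sum_i rnorm (v i) ^+ 2).

(* Operator norm from l2(J) to l2(I). *)
Definition opnorm (I J : finType) (a : I -> J -> C) : R :=
  sup [set l2norm (fun i => \sum_j a i j * v j : C) |
    v in [set v : J -> C | l2norm v <= 1]].

Section sums.
Context (I J : finType).
Implicit Types (v : I -> C).

Lemma l2norm_ge0 v : 0 <= l2norm v. Proof. exact: sqrtr_ge0. Qed.

Lemma l2norm_sqr v : l2norm v ^+ 2 = \sum_i rnorm (v i) ^+ 2.
Proof. by rewrite sqr_sqrtr// sumr_ge0// => i _; rewrite sqr_ge0. Qed.

Lemma l2norm_coord v i : rnorm (v i) <= l2norm v.
Proof.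
rewrite -ler_sqr ?nnegrE ?rnorm_ge0 ?l2norm_ge0// l2norm_sqr.
by rewrite (bigD1 i)//= lerDl sumr_ge0// => j _; rewrite sqr_ge0.
Qed.

Lemma cauchy_schwarz (a b : I -> R) : (forall i, 0 <= a i) -> (forall i, 0 <= b i) ->
  \sum_i a i * b i <= Num.sqrt (\sum_i a i ^+ 2) * Num.sqrt (\sum_i b i ^+ 2).
Proof.
move=> a0 b0; have sq0 (c : I -> R) : 0 <= \sum_i c i ^+ 2.
  by apply: sumr_ge0 => i _; rewrite sqr_ge0.
rewrite -ler_sqr ?nnegrE ?mulr_ge0 ?sqrtr_ge0//; last first.
  by apply: sumr_ge0 => i _; rewrite mulr_ge0.
rewrite exprMn !sqr_sqrtr// -subr_ge0 -(pmulrn_lge0 _ (n := 2))//.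
have -> : ((\sum_i a i ^+ 2) * (\sum_i b i ^+ 2) - (\sum_i a i * b i) ^+ 2) *+ 2 =
    \sum_i \sum_j (a i * b j - a j * b i) ^+ 2.
  have S : \sum_i \sum_j (a i ^+ 2 * b j ^+ 2) = \sum_i \sum_j (a j ^+ 2 * b i ^+ 2).
    by rewrite exchange_big.
  transitivity (\sum_i \sum_j (a i ^+ 2 * b j ^+ 2) + \sum_i \sum_j (a j ^+ 2 * b i ^+ 2)
      - (\sum_i \sum_j (a i * b i) * (a j * b j)) *+ 2).
    by rewrite expr2 !big_distrlr/= -S; ring.
  rewrite -sumrMnl -big_split -sumrN -big_split; apply: eq_bigr => i _ /=.
  by rewrite -sumrMnl -big_split -sumrN -big_split; apply: eq_bigr => j _ /=; ring.
by apply: sumr_ge0 => i _; apply: sumr_ge0 => j _; rewrite sqr_ge0.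
Qed.

Lemma l2norm_dot u v : rnorm (\sum_i u i * v i : C) <= l2norm u * l2norm v.
Proof.
rewrite (le_trans (rnorm_sum _ _ _))//; under eq_bigr do rewrite rnormM.
by apply: cauchy_schwarz => i; rewrite rnorm_ge0.
Qed.

End sums.

Section sums2.
Context (I J : finType).
Implicit Types (a : I -> J -> C) (u : I -> C) (v : J -> C).

Definition bil a u v : C := \sum_i \sum_j u i * v j * a i j.

Lemma bilE a u v : bil a u v = \sum_i u i * \sum_j a i j * v j.
Proof.
apply: eq_bigr => i _; rewrite mulr_sumr; apply: eq_bigr => j _.
by rewrite -mulrA [v j * _]mulrC.
Qed.

Lemma bilEr a u v : bil a u v = \sum_j (\sum_i u i * a i j) * v j.
Proof.
rewrite /bil exchange_big; apply: eq_bigr => j _ /=; rewrite mulr_suml.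
by apply: eq_bigr => i _; rewrite mulrAC.
Qed.

Lemma l2norm_dual (u : I -> C) (c : R) : 0 <= c ->
  (forall w : I -> C, rnorm (\sum_i w i * u i : C) <= c * l2norm w) ->
  l2norm u <= c.
Proof.
move=> c0 h; have := h (fun i => (u i)^*%C).
have -> : l2norm (fun i => (u i)^*%C : C) = l2norm u.
  by congr Num.sqrt; apply: eq_bigr => i _; rewrite rnormcJ.
have -> : rnorm (\sum_i (u i)^*%C * u i : C) = l2norm u ^+ 2.
  apply: complexI; rewrite -rnormE l2norm_sqr rmorph_sum/= ger0_norm.
    by apply: eq_bigr => i _; rewrite mulrC -sqr_normc rmorphXn/= -rnormE.
  by apply: sumr_ge0 => i _; rewrite mulrC -sqr_normc exprn_ge0.
rewrite expr2; have [->//|u0] := eqVneq (l2norm u) 0.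
by rewrite ler_pM2r// lt_neqAle eq_sym u0 l2norm_ge0.
Qed.

Lemma opnorm_has_sup a : has_sup
  [set l2norm (fun i => \sum_j a i j * v j : C) |
    v in [set v : J -> C | l2norm v <= 1]].
Proof.
split.
  exists (l2norm (fun i => \sum_j a i j * 0 : C)), (fun=> 0) => //=.
  rewrite /l2norm big1 ?sqrtr0 ?ler01// => i _.
  by rewrite (rnorm0 (R[i]^o)) expr0n.
exists (Num.sqrt (\sum_i (\sum_j rnorm (a i j)) ^+ 2)) => _ [v /= v1 <-].
apply: ler_wsqrtr; apply: ler_sum => i _; rewrite ler_sqr ?nnegrE ?rnorm_ge0//.
  rewrite (le_trans (rnorm_sum _ _ _))//; apply: ler_sum => j _.
  by rewrite rnormM ler_piMr ?rnorm_ge0// (le_trans (l2norm_coord _ _)).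
by rewrite sumr_ge0// => j _; rewrite rnorm_ge0.
Qed.

Lemma opnorm_ge0 a : 0 <= opnorm a.
Proof.
have [[r ar] ub] := opnorm_has_sup a.
by apply: le_trans (ub_le_sup ub ar); case: ar => v _ <-; exact: l2norm_ge0.
Qed.

Lemma l2normZ (c : R[i]) u : l2norm (fun i => c * u i : C) = rnorm (c : C) * l2norm u.
Proof.
rewrite /l2norm; under eq_bigr do rewrite rnormM exprMn.
by rewrite -mulr_sumr sqrtrM ?sqr_ge0// sqrtr_sqr ger0_norm ?rnorm_ge0.
Qed.

Lemma l2norm_eq0 u i : l2norm u = 0 -> u i = 0.
Proof.
move=> u0; apply: (@rnorm_eq0 _ (R[i]^o)); apply/eqP.
by rewrite eq_le rnorm_ge0 andbT -u0 l2norm_coord.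
Qed.

End sums2.

Lemma rnorm_real (c : R) : 0 <= c -> rnorm (c%:C : C) = c.
Proof. by move=> c0; rewrite /rnorm ger0_norm// ler0c. Qed.

Section sums3.
Context (I J : finType).
Implicit Types (a : I -> J -> C) (u : I -> C) (v : J -> C).

Lemma l2norm_opnorm a v :
  l2norm (fun i => \sum_j a i j * v j : C) <= opnorm a * l2norm v.
Proof.
have [v0|v0] := eqVneq (l2norm v) 0.
  rewrite v0 mulr0 /l2norm big1 ?sqrtr0// => i _.
  rewrite big1 ?(rnorm0 (R[i]^o)) ?expr0n// => j _.
  by rewrite (l2norm_eq0 j v0) mulr0.
have v0' : 0 < l2norm v by rewrite lt_neqAle eq_sym v0 l2norm_ge0.
have [_ ub] := opnorm_has_sup a.
rewrite -ler_pdivrMr//; apply: (ub_le_sup ub).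
have nV : rnorm ((l2norm v)^-1%:C : C) = (l2norm v)^-1.
  by rewrite rnorm_real// invr_ge0 l2norm_ge0.
exists (fun j => (l2norm v)^-1%:C * v j) => /=.
  by rewrite l2normZ nV mulVf.
rewrite [RHS]mulrC -[in RHS]nV -l2normZ; congr (l2norm _); apply/funext => i /=.
by rewrite mulr_sumr; apply: eq_bigr => j _; rewrite mulrCA.
Qed.

Lemma bil_le a u v : rnorm (bil a u v) <= opnorm a * l2norm u * l2norm v.
Proof.
rewrite bilE (le_trans (l2norm_dot _ _))// mulrAC mulrC.
by rewrite ler_wpM2r ?l2norm_ge0// l2norm_opnorm.
Qed.

Lemma opnorm_le a (c : R) : 0 <= c ->
  (forall u v, rnorm (bil a u v) <= c * l2norm u * l2norm v) -> opnorm a <= c.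
Proof.
move=> c0 h; apply: ge_sup; first by have [] := opnorm_has_sup a.
move=> _ [v /= v1 <-]; apply: l2norm_dual => // w; rewrite -bilE.
by rewrite (le_trans (h _ _))// ler_piMr// mulr_ge0// l2norm_ge0.
Qed.

Lemma l2norm_tr a u :
  l2norm (fun j => \sum_i u i * a i j : C) <= opnorm a * l2norm u.
Proof.
apply: l2norm_dual; first by rewrite mulr_ge0 ?opnorm_ge0 ?l2norm_ge0.
move=> w; rewrite (_ : \sum_i _ = bil a u w) ?bil_le// bilEr.
by apply: eq_bigr => j _; rewrite mulrC.
Qed.

End sums3.
End L2.

(* The product a x b of scalar matrices with a matrix over X. *)
Definition mxscale (R : realType) (X : lmodType R[i]) (m n : nat)
    (a : 'M[R[i]]_(n, m)) (x : 'M[X]_m) (b : 'M[R[i]]_(m, n)) : 'M[X]_n :=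
  \matrix_(i, j) \sum_k \sum_l (a i k * b l j) *: x k l.

(* Abstract operator spaces (Ruan): a norm on each M_n(X), with the axioms  *)
(* |x (+) y| = max(|x|, |y|) and |a x b| <= |a| |x| |b|.                     *)
HB.mixin Record isOperatorSpace (R : realType) X & NormedModule R[i] X := {
  mnorm : forall n : nat, 'M[X]_n -> R ;
  mnorm_mx11 : forall x : X, mnorm 1 (const_mx x) = rnorm x ;
  mnorm_eq0 : forall n (x : 'M[X]_n), mnorm n x = 0 -> x = 0 ;
  mnormD : forall n (x y : 'M[X]_n), mnorm n (x + y) <= mnorm n x + mnorm n y ;
  mnormZ : forall n (c : R[i]) (x : 'M[X]_n),
    mnorm n (map_mx ( *:%R c) x) = rnorm (c : R[i]^o) * mnorm n x ;
  mnorm_block : forall m n (x : 'M[X]_m) (y : 'M[X]_n),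
    mnorm (m + n) (block_mx x 0 0 y) = Num.max (mnorm m x) (mnorm n y) ;
  mnorm_scale : forall m n (a : 'M[R[i]]_(n, m)) (x : 'M[X]_m)
      (b : 'M[R[i]]_(m, n)),
    mnorm n (mxscale a x b) <=
      opnorm (fun i j => a i j) * mnorm m x * opnorm (fun i j => b i j) }.

#[short(type="operatorSpaceType")]
HB.structure Definition OperatorSpace (R : realType) :=
  {X of isOperatorSpace R X & NormedModule R[i] X}.

#[short(type="completeOperatorSpaceType")]
HB.structure Definition CompleteOperatorSpace (R : realType) :=
  {X of OperatorSpace R X & Complete X}.
Arguments mnorm {R s n}.

Section MnormTheory.
Context (R : realType) (X : operatorSpaceType R).
Local Notation C := R[i]^o.

Lemma mnorm0 m : mnorm (0 : 'M[X]_m) = 0.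
Proof.
have -> : 0 = map_mx ( *:%R 0) (0 : 'M[X]_m).
  by apply/matrixP => i j; rewrite !mxE scale0r.
by rewrite mnormZ (rnorm0 (R[i]^o)) mul0r.
Qed.

Lemma mnorm_ge0 m (x : 'M[X]_m) : 0 <= mnorm x.
Proof.
have := mnormD _ x (map_mx ( *:%R (-1)) x); rewrite mnormZ.
have -> : x + map_mx ( *:%R (-1)) x = 0.
  by apply/matrixP => i j; rewrite !mxE scaleN1r subrr.
have -> : rnorm (-1 : C) = 1 by rewrite /rnorm normrN1.
by rewrite mnorm0 mul1r -mulr2n pmulrn_lge0.
Qed.

Definition sandwich m (x : 'M[X]_m) (u v : 'I_m -> C) : X :=
  \sum_k \sum_l (u k * v l) *: x k l.

Lemma sandwich_suml (I : finType) m (x : 'M[X]_m) (U : I -> 'I_m -> C) (c : I -> C) v :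
  sandwich x (fun k => \sum_i U i k * c i : C) v = \sum_i c i *: sandwich x (U i) v.
Proof.
under [RHS]eq_bigr do rewrite scaler_sumr.
rewrite exchange_big; apply: eq_bigr => k _.
under [RHS]eq_bigr do rewrite scaler_sumr.
rewrite exchange_big; apply: eq_bigr => l _.
rewrite mulr_suml scaler_suml; apply: eq_bigr => i _.
by rewrite scalerA mulrA [c i * _]mulrC.
Qed.

Lemma sandwich_sumr (I : finType) m (x : 'M[X]_m) u (V : I -> 'I_m -> C) (c : I -> C) :
  sandwich x u (fun k => \sum_i c i * V i k : C) = \sum_i c i *: sandwich x u (V i).
Proof.
under [RHS]eq_bigr do rewrite scaler_sumr.
rewrite exchange_big; apply: eq_bigr => k _.
under [RHS]eq_bigr do rewrite scaler_sumr.
rewrite exchange_big; apply: eq_bigr => l _.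
rewrite mulr_sumr scaler_suml; apply: eq_bigr => i _.
by rewrite scalerA mulrCA.
Qed.

Lemma rnorm_sandwich m (x : 'M[X]_m) u v :
  rnorm (sandwich x u v) <= mnorm x * l2norm u * l2norm v.
Proof.
pose a := \row_k u k : 'rV[R[i]]_m; pose b := \col_k v k : 'cV[R[i]]_m.
have -> : rnorm (sandwich x u v) = mnorm (mxscale a x b).
  rewrite -mnorm_mx11; congr mnorm; apply/matrixP => i j; rewrite !mxE.
  by apply: eq_bigr => k _; apply: eq_bigr => l _; rewrite !mxE.
rewrite (le_trans (mnorm_scale _ _ _ _ _))//.
have ha : opnorm (fun i j => a i j) <= l2norm u.
  apply: opnorm_le => [|u' v']; first exact: l2norm_ge0.
  rewrite bilE big_ord1 rnormM -mulrA mulrCA; apply: ler_pM; rewrite ?rnorm_ge0//.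
    exact: l2norm_coord.
  rewrite (le_trans _ (l2norm_dot _ _))//.
  by under eq_bigr do rewrite mxE.
have hb : opnorm (fun i j => b i j) <= l2norm v.
  apply: opnorm_le => [|u' v']; first exact: l2norm_ge0.
  rewrite bilEr big_ord1 rnormM; apply: ler_pM; rewrite ?rnorm_ge0//.
    rewrite mulrC (le_trans _ (l2norm_dot _ _))//.
    by under eq_bigr do rewrite mxE.
  exact: l2norm_coord.
rewrite [mnorm x * _]mulrC.
by rewrite ler_pM ?ler_wpM2r ?mulr_ge0 ?opnorm_ge0 ?mnorm_ge0.
Qed.

End MnormTheory.

Section DualOperatorSpace.
Context (R : realType) (X : operatorSpaceType R).
Local Notation C := R[i]^o.

(* The matrix [f_ij(x_kl)] with rows (i, k) and columns (j, l). *)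
Definition dual_pairing (n m : nat) (f : 'M[dual X]_n) (x : 'M[X]_m) :
    'I_n * 'I_m -> 'I_n * 'I_m -> C :=
  fun p q => f p.1 q.1 (x p.2 q.2).

(* Dual operator space structure: M_n(dual X) = CB(X, M_n), with the           *)
(* completely bounded norm of x |-> [f_ij(x)].                               *)
Definition dual_mnorm (n : nat) (f : 'M[dual X]_n) : R :=
  sup [set r : R | exists m (x : 'M[X]_m),
    mnorm x <= 1 /\ r = opnorm (dual_pairing f x)].

Lemma dual_sumE (I : Type) (r : seq I) (P : pred I) (F : I -> dual X) y :
  (\sum_(i <- r | P i) F i) y = \sum_(i <- r | P i) F i y.
Proof. by elim/big_rec2 : _ => // i _ g _ <-. Qed.

Lemma sum_pair_mx n m (F : 'I_n * 'I_m -> 'I_n * 'I_m -> C) :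
  \sum_p \sum_q F p q =
  \sum_i \sum_j \sum_k \sum_l F (i, k) (j, l).
Proof.
transitivity (\sum_i \sum_k \sum_j \sum_l F (i, k) (j, l)); last first.
  by apply: eq_bigr => i _; rewrite exchange_big.
rewrite [RHS]pair_bigA/=; apply: eq_bigr => -[i k] _ /=.
by rewrite [RHS]pair_bigA/=; apply: eq_bigr => -[j l] _.
Qed.

Lemma bil_pairing n m (f : 'M[dual X]_n) (x : 'M[X]_m) u v :
  bil (dual_pairing f x) u v =
  \sum_i \sum_j f i j (sandwich x (fun k => u (i, k)) (fun l => v (j, l))).
Proof.
rewrite /bil sum_pair_mx; apply: eq_bigr => i _; apply: eq_bigr => j _.
rewrite linear_sum; apply: eq_bigr => k _; rewrite linear_sum.
by apply: eq_bigr => l _; rewrite linearZ.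
Qed.

Lemma l2norm_slice n m (u : 'I_n * 'I_m -> C) i :
  l2norm (fun k => u (i, k)) <= l2norm u.
Proof.
apply: ler_wsqrtr.
rewrite [leRHS](_ : _ = \sum_i \sum_k rnorm (u (i, k)) ^+ 2); last first.
  by rewrite pair_bigA; apply: eq_bigr => -[].
rewrite [leRHS](bigD1 i)//= lerDl; apply: sumr_ge0 => j _.
by apply: sumr_ge0 => k _; rewrite sqr_ge0.
Qed.

Lemma bil_pairing_le n m (f : 'M[dual X]_n) (x : 'M[X]_m) u v :
  rnorm (bil (dual_pairing f x) u v) <=
  (\sum_i \sum_j dnorm (f i j)) * mnorm x * l2norm u * l2norm v.
Proof.
rewrite bil_pairing (le_trans (rnorm_sum _ _ _))// !mulr_suml.
apply: ler_sum => i _; rewrite (le_trans (rnorm_sum _ _ _))// !mulr_suml.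
apply: ler_sum => j _; rewrite (le_trans (dnormP _ _))// -!mulrA.
rewrite ler_wpM2l ?dnorm_ge0// (le_trans (rnorm_sandwich _ _ _))//.
rewrite -mulrA ler_wpM2l ?mnorm_ge0//.
by rewrite ler_pM ?l2norm_ge0 ?l2norm_slice.
Qed.

Lemma dual_mnorm_has_sup n (f : 'M[dual X]_n) :
  has_sup [set r : R | exists m (x : 'M[X]_m),
    mnorm x <= 1 /\ r = opnorm (dual_pairing f x)].
Proof.
split.
  by exists (opnorm (dual_pairing f (0 : 'M[X]_0%N))), 0%N, 0; rewrite mnorm0 ler01.
have M0 : 0 <= \sum_i \sum_j dnorm (f i j).
  by apply: sumr_ge0 => i _; apply: sumr_ge0 => j _; exact: dnorm_ge0.
exists (\sum_i \sum_j dnorm (f i j)) => _ [m [x [x1 ->]]].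
apply: opnorm_le => // u v; rewrite (le_trans (bil_pairing_le _ _ _ _))//.
by do 2 rewrite ler_wpM2r ?l2norm_ge0//; rewrite ler_piMr.
Qed.

Lemma dual_mnorm_ge0 n (f : 'M[dual X]_n) : 0 <= dual_mnorm f.
Proof.
have [[r fr] ub] := dual_mnorm_has_sup f.
by apply: le_trans (ub_le_sup ub fr); case: fr => m [x [_ ->]]; exact: opnorm_ge0.
Qed.

Lemma dual_mnormP n m (f : 'M[dual X]_n) (x : 'M[X]_m) u v :
  rnorm (bil (dual_pairing f x) u v) <=
  dual_mnorm f * mnorm x * l2norm u * l2norm v.
Proof.
have [x0|x0] := eqVneq (mnorm x) 0.
  rewrite (le_trans (bil_pairing_le _ _ _ _))//.
  by rewrite x0 !mulr0.
have x0' : 0 < mnorm x by rewrite lt_neqAle eq_sym x0 mnorm_ge0.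
pose c := mnorm x; pose y := map_mx ( *:%R c^-1%:C) x.
have y1 : mnorm y <= 1.
  by rewrite mnormZ rnorm_real ?invr_ge0 ?mnorm_ge0// mulVf.
have -> : bil (dual_pairing f x) u v = c%:C * bil (dual_pairing f y) u v.
  rewrite /bil mulr_sumr; apply: eq_bigr => p _; rewrite mulr_sumr.
  apply: eq_bigr => q _; rewrite mulrCA /dual_pairing mxE linearZ/=.
  congr (_ * _); rewrite -[in RHS]/(c%:C * (c^-1%:C * _)).
  by rewrite mulrA -rmorphM/= mulfV// mul1r.
rewrite rnormM rnorm_real ?mnorm_ge0// -/c [_ * c]mulrC -!mulrA.
rewrite ler_wpM2l ?mnorm_ge0// mulrA (le_trans (bil_le _ _ _))//.
do 2 rewrite ler_wpM2r ?l2norm_ge0//.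
have [_ ub] := dual_mnorm_has_sup f; apply: (ub_le_sup ub).
by exists m, y.
Qed.

Lemma dual_mnorm_le n (f : 'M[dual X]_n) (c : R) : 0 <= c ->
  (forall m (x : 'M[X]_m) u v, rnorm (bil (dual_pairing f x) u v) <=
    c * mnorm x * l2norm u * l2norm v) -> dual_mnorm f <= c.
Proof.
move=> c0 h; have [ne _] := dual_mnorm_has_sup f; apply: ge_sup => //.
move=> _ [m [x [x1 ->]]]; apply: opnorm_le => // u v.
rewrite (le_trans (h _ _ _ _))//.
by do 2 rewrite ler_wpM2r ?l2norm_ge0//; rewrite ler_piMr.
Qed.

Let l2norm_le1 (I : finType) (i0 : I) :
  l2norm (fun i => (i == i0)%:R : C) = 1.
Proof.
rewrite /l2norm (bigD1 i0)//= eqxx big1 ?addr0.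
  by rewrite (rnorm_real (c := 1)) ?expr1n ?sqrtr1// ler01.
by move=> i /negbTE->; rewrite (rnorm0 (R[i]^o)) expr0n.
Qed.

Lemma dual_mnorm_coord n (f : 'M[dual X]_n) i j : dnorm (f i j) <= dual_mnorm f.
Proof.
apply: dnorm_le => [|x]; first exact: dual_mnorm_ge0.
have := @dual_mnormP n 1 f (const_mx x) (fun p => (p == (i, ord0))%:R)
  (fun p => (p == (j, ord0))%:R).
rewrite !l2norm_le1 !mulr1 mnorm_mx11; apply: le_trans.
rewrite bilE (bigD1 (i, ord0))//= eqxx mul1r (bigD1 (j, ord0))//= eqxx mulr1.
rewrite /dual_pairing/= mxE big1 ?addr0; last first.
  by move=> p /negbTE->; rewrite mulr0.
by rewrite big1 ?addr0// => p /negbTE->; rewrite mul0r.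
Qed.

Let dual_mnorm_mx11 (f : dual X) : dual_mnorm (const_mx f : 'M[dual X]_1%N) = rnorm f.
Proof.
apply/eqP; rewrite eq_le; apply/andP; split; last first.
  by have := dual_mnorm_coord (const_mx f : 'M[dual X]_1%N) ord0 ord0; rewrite mxE.
apply: dual_mnorm_le => [|m x u v]; first exact: rnorm_ge0.
by rewrite (le_trans (bil_pairing_le _ _ _ _))// !big_ord1 mxE.
Qed.

Let dual_mnorm_eq0 n (f : 'M[dual X]_n) : dual_mnorm f = 0 -> f = 0.
Proof.
move=> f0; apply/matrixP => i j; rewrite [RHS]mxE; apply: rnorm_eq0; apply/eqP.
by rewrite eq_le rnorm_ge0 andbT dual_rnormE -f0 dual_mnorm_coord.
Qed.

Let dual_mnormD n (f g : 'M[dual X]_n) :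
  dual_mnorm (f + g) <= dual_mnorm f + dual_mnorm g.
Proof.
apply: dual_mnorm_le => [|m x u v]; first by rewrite addr_ge0 ?dual_mnorm_ge0.
have -> : bil (dual_pairing (f + g) x) u v =
    bil (dual_pairing f x) u v + bil (dual_pairing g x) u v.
  rewrite /bil -big_split; apply: eq_bigr => p _ /=; rewrite -big_split.
  by apply: eq_bigr => q _ /=; rewrite -mulrDr /dual_pairing mxE.
by rewrite (le_trans (rnormD _ _))// !mulrDl lerD// dual_mnormP.
Qed.

Let dual_mnormZ n (c : R[i]) (f : 'M[dual X]_n) :
  dual_mnorm (map_mx ( *:%R c) f) = rnorm (c : C) * dual_mnorm f.
Proof.
have le b g : dual_mnorm (map_mx ( *:%R b) g : 'M[dual X]_n) <=
    rnorm (b : C) * dual_mnorm g.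
  apply: dual_mnorm_le => [|m x u v].
    by rewrite mulr_ge0 ?dual_mnorm_ge0 ?rnorm_ge0.
  have -> : bil (dual_pairing (map_mx ( *:%R b) g) x) u v =
      b * bil (dual_pairing g x) u v.
    rewrite /bil mulr_sumr; apply: eq_bigr => p _; rewrite mulr_sumr.
    by apply: eq_bigr => q _; rewrite mulrCA /dual_pairing mxE.
  by rewrite rnormM -!mulrA ler_wpM2l ?rnorm_ge0// !mulrA dual_mnormP.
apply/eqP; rewrite eq_le le/=.
have [->|c0] := eqVneq c 0.
  by rewrite (rnorm0 (R[i]^o)) mul0r dual_mnorm_ge0.
have c0' : 0 < rnorm (c : C).
  rewrite lt_neqAle rnorm_ge0 eq_sym andbT.
  by apply: contra c0 => /eqP/rnorm_eq0 ->.
rewrite mulrC -ler_pdivlMr// mulrC.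
have := le c^-1 (map_mx ( *:%R c) f).
have -> : map_mx ( *:%R c^-1) (map_mx ( *:%R c) f) = f.
  by apply/matrixP => i j; rewrite !mxE scalerA mulVf// scale1r.
by have -> : rnorm (c^-1 : C) = (rnorm (c : C))^-1
  by apply: complexI; rewrite -rnormE normfV fmorphV/= -rnormE.
Qed.

Let dual_mnorm_scale m n (a : 'M[R[i]]_(n, m)) (f : 'M[dual X]_m)
    (b : 'M[R[i]]_(m, n)) :
  dual_mnorm (mxscale a f b) <=
    opnorm (fun i j => a i j) * dual_mnorm f * opnorm (fun i j => b i j).
Proof.
apply: dual_mnorm_le => [|r x u v].
  by rewrite !mulr_ge0 ?dual_mnorm_ge0 ?opnorm_ge0.
pose u' p : C := \sum_i u (i, p.2) * a i p.1.
pose v' p : C := \sum_j b p.1 j * v (j, p.2).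
have -> : bil (dual_pairing (mxscale a f b) x) u v =
    bil (dual_pairing f x) u' v'.
  rewrite !bil_pairing.
  pose S i j := sandwich x (fun k => u (i, k)) (fun l => v (j, l)).
  transitivity (\sum_i \sum_j \sum_p \sum_q a i p * (b q j * f p q (S i j)) : C).
    apply: eq_bigr => i _; apply: eq_bigr => j _; rewrite mxE dual_sumE.
    apply: eq_bigr => p _; rewrite dual_sumE; apply: eq_bigr => q _.
    by rewrite mulrA.
  transitivity (\sum_p \sum_q \sum_i \sum_j a i p * (b q j * f p q (S i j)) : C).
    transitivity (\sum_p \sum_i \sum_j \sum_q a i p * (b q j * f p q (S i j)) : C).
      by rewrite [RHS]exchange_big; apply: eq_bigr => i _; rewrite exchange_big.
    apply: eq_bigr => p _; rewrite [RHS]exchange_big; apply: eq_bigr => i _.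
    by rewrite exchange_big.
  apply: eq_bigr => p _; apply: eq_bigr => q _.
  rewrite (sandwich_suml x (fun i k => u (i, k)) (fun i => a i p)) linear_sum.
  apply: eq_bigr => i _; 
  rewrite (sandwich_sumr x _ (fun j l => v (j, l)) (fun j => b q j)) linearZ linear_sum.
  rewrite -[RHS]/(a i p * (\sum_j _) : R[i]) mulr_sumr.
  by apply: eq_bigr => j _; rewrite linearZ.
have sl (I : nat) (w : 'I_I * 'I_r -> C) : l2norm w ^+ 2 = \sum_k l2norm (fun i => w (i, k)) ^+ 2.
  rewrite l2norm_sqr; under [RHS]eq_bigr do rewrite l2norm_sqr.
  by rewrite exchange_big pair_bigA/=; apply: eq_bigr => -[].
have hu : l2norm u' <= opnorm (fun i j => a i j) * l2norm u.
  rewrite -ler_sqr ?nnegrE ?mulr_ge0 ?l2norm_ge0 ?opnorm_ge0// exprMn !sl mulr_sumr.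
  apply: ler_sum => k _; rewrite -exprMn ler_sqr ?nnegrE ?mulr_ge0 ?l2norm_ge0 ?opnorm_ge0//.
  exact: (l2norm_tr (fun i j => a i j) (fun i => u (i, k))).
have hv : l2norm v' <= opnorm (fun i j => b i j) * l2norm v.
  rewrite -ler_sqr ?nnegrE ?mulr_ge0 ?l2norm_ge0 ?opnorm_ge0// exprMn !sl mulr_sumr.
  apply: ler_sum => k _; rewrite -exprMn ler_sqr ?nnegrE ?mulr_ge0 ?l2norm_ge0 ?opnorm_ge0//.
  exact: (l2norm_opnorm (fun i j => b i j) (fun i => v (i, k))).
rewrite (le_trans (dual_mnormP _ _ _ _))//.
set oa := opnorm _; set ob := opnorm _.
have -> : oa * dual_mnorm f * ob * mnorm x * l2norm u * l2norm v =
  dual_mnorm f * mnorm x * (oa * l2norm u) * (ob * l2norm v) by ring.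
by rewrite ler_pM ?ler_wpM2l ?mulr_ge0 ?dual_mnorm_ge0 ?mnorm_ge0 ?l2norm_ge0.
Qed.

Let dual_mnorm_block m n (f : 'M[dual X]_m) (g : 'M[dual X]_n) :
  dual_mnorm (block_mx f 0 0 g) = Num.max (dual_mnorm f) (dual_mnorm g).
Proof.
have bilb r (x : 'M[X]_r) u v : bil (dual_pairing (block_mx f 0 0 g) x) u v =
    bil (dual_pairing f x) (fun p => u (lshift n p.1, p.2)) (fun p => v (lshift n p.1, p.2))
    + bil (dual_pairing g x) (fun p => u (rshift m p.1, p.2)) (fun p => v (rshift m p.1, p.2)).
  rewrite !bil_pairing big_split_ord/=; congr (_ + _).
    apply: eq_bigr => i _; rewrite big_split_ord/= [X in _ + X]big1 ?addr0.
      by apply: eq_bigr => j _; rewrite block_mxEul.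
    by move=> j _; rewrite block_mxEur mxE.
  apply: eq_bigr => i _; rewrite big_split_ord/= [X in X + _]big1 ?add0r.
    by apply: eq_bigr => j _; rewrite block_mxEdr.
  by move=> j _; rewrite block_mxEdl mxE.
have l2b r (u : 'I_(m + n) * 'I_r -> C) : l2norm u ^+ 2 =
    l2norm (fun p : 'I_m * 'I_r => u (lshift n p.1, p.2)) ^+ 2
    + l2norm (fun p : 'I_n * 'I_r => u (rshift m p.1, p.2)) ^+ 2.
  rewrite !l2norm_sqr.
  transitivity (\sum_(i : 'I_(m + n)) \sum_k rnorm (u (i, k)) ^+ 2).
    by rewrite pair_bigA; apply: eq_bigr => -[].
  by rewrite big_split_ord/=; congr (_ + _); rewrite pair_bigA.
apply/eqP; rewrite eq_le; apply/andP; split.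
  apply: dual_mnorm_le => [|r x u v]; first by rewrite le_max dual_mnorm_ge0.
  set M := Num.max _ _; rewrite bilb (le_trans (rnormD _ _))//.
  set u1 := fun _ => u (lshift _ _, _); set v1 := fun _ => v (lshift _ _, _).
  set u2 := fun _ => u (rshift _ _, _); set v2 := fun _ => v (rshift _ _, _).
  have h1 : rnorm (bil (dual_pairing f x) u1 v1) <= M * mnorm x * (l2norm u1 * l2norm v1).
    rewrite (le_trans (dual_mnormP _ _ _ _))// -mulrA.
    by rewrite !ler_wpM2r ?mulr_ge0 ?l2norm_ge0 ?mnorm_ge0// le_max lexx.
  have h2 : rnorm (bil (dual_pairing g x) u2 v2) <= M * mnorm x * (l2norm u2 * l2norm v2).
    rewrite (le_trans (dual_mnormP _ _ _ _))// -mulrA.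
    by rewrite !ler_wpM2r ?mulr_ge0 ?l2norm_ge0 ?mnorm_ge0// le_max lexx orbT.
  rewrite (le_trans (lerD h1 h2))// -mulrDr -mulrA ler_wpM2l//.
    by rewrite mulr_ge0 ?mnorm_ge0// le_max dual_mnorm_ge0.
  rewrite -ler_sqr ?nnegrE ?addr_ge0 ?mulr_ge0 ?l2norm_ge0//.
  rewrite [leRHS]exprMn !l2b -/u1 -/u2 -/v1 -/v2 -subr_ge0.
  set a := l2norm u1; set b := l2norm u2; set c := l2norm v1; set d := l2norm v2.
  by rewrite [leRHS](_ : _ = (a * d - b * c) ^+ 2) ?sqr_ge0//; ring.
rewrite ge_max; apply/andP; split; apply: dual_mnorm_le => [|r x u v];
  rewrite ?dual_mnorm_ge0//.
  pose ext (w : 'I_m * 'I_r -> C) (p : 'I_(m + n) * 'I_r) : C :=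
    if fintype.split p.1 is inl i then w (i, p.2) else 0.
  have e1 w : (fun p => ext w (lshift n p.1, p.2)) = w.
    by apply/funext => -[i k]; rewrite /ext/= (unsplitK (inl i)).
  have e2 w : (fun p : 'I_n * 'I_r => ext w (rshift m p.1, p.2)) = fun=> 0.
    by apply/funext => -[i k]; rewrite /ext/= (unsplitK (inr i)).
  have z : l2norm ((fun=> 0) : 'I_n * 'I_r -> C) = 0.
    by rewrite /l2norm big1 ?sqrtr0// => i _; rewrite (rnorm0 (R[i]^o)) expr0n.
  have l w : l2norm (ext w) = l2norm w.
    apply/eqP; rewrite -(eqrXn2 (n := 2))// ?l2norm_ge0// l2b e1 e2.
    by rewrite [in X in _ + X]z expr0n addr0.
  have := @dual_mnormP _ _ (block_mx f 0 0 g) x (ext u) (ext v).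
  rewrite bilb !e1 !e2 !l; congr (_ <= _); congr rnorm.
  by rewrite /bil [X in _ + X]big1 ?addr0// => p _; rewrite big1// => q _; rewrite !mul0r.
pose ext (w : 'I_n * 'I_r -> C) (p : 'I_(m + n) * 'I_r) : C :=
  if fintype.split p.1 is inr i then w (i, p.2) else 0.
have e1 w : (fun p => ext w (rshift m p.1, p.2)) = w.
  by apply/funext => -[i k]; rewrite /ext/= (unsplitK (inr i)).
have e2 w : (fun p : 'I_m * 'I_r => ext w (lshift n p.1, p.2)) = fun=> 0.
  by apply/funext => -[i k]; rewrite /ext/= (unsplitK (inl i)).
have z : l2norm ((fun=> 0) : 'I_m * 'I_r -> C) = 0.
  by rewrite /l2norm big1 ?sqrtr0// => i _; rewrite (rnorm0 (R[i]^o)) expr0n.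
have l w : l2norm (ext w) = l2norm w.
  apply/eqP; rewrite -(eqrXn2 (n := 2))// ?l2norm_ge0// l2b e1 e2.
  by rewrite [in X in X + _]z expr0n add0r.
have := @dual_mnormP _ _ (block_mx f 0 0 g) x (ext u) (ext v).
rewrite bilb !e1 !e2 !l; congr (_ <= _); congr rnorm.
by rewrite /bil [X in X + _]big1 ?add0r// => p _; rewrite big1// => q _; rewrite !mul0r.
Qed.

HB.instance Definition _ := isOperatorSpace.Build R (dual X)
  dual_mnorm_mx11 dual_mnorm_eq0 dual_mnormD dual_mnormZ dual_mnorm_block
  dual_mnorm_scale.

End DualOperatorSpace.

Section Bidual.
Context (R : realType) (X : normedModType R[i]).

Lemma bounded_dual_pred (V : normedModType R[i]) (g : V -> R[i]^o) (M : R) :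
  linear g -> (forall v, rnorm (g v) <= M * rnorm v) -> g \in dual_pred (X := V).
Proof.
move=> gl gM; apply/asboolP; split=> //.
pose g' : {linear V -> R[i]^o} :=
  HB.pack g (GRing.isLinear.Build R[i] V R[i]^o _ g gl).
apply: (@bounded_linear_continuous _ _ _ g'); apply/linear_boundedP.
exists (Num.max M 0)%:C; split=> [|r Mr v].
  by rewrite realE ler0c le_max lexx orbT.
rewrite (rnormE (g' v)) (rnormE v) (@le_trans _ _ ((Num.max M 0)%:C * (rnorm v)%:C))//.
  rewrite -rmorphM lecR (le_trans (gM v))//.
  by rewrite ler_wpM2r ?rnorm_ge0// le_max lexx.
by rewrite ler_wpM2r ?ler0c ?rnorm_ge0// ltW.
Qed.

Definition eval_at (x : X) : dual X -> R[i]^o := fun f => f x.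

Lemma eval_at_dual (x : X) : eval_at x \in dual_pred (X := dual X).
Proof.
apply: (@bounded_dual_pred _ _ (rnorm x)) => [a f g //|f].
by rewrite mulrC dnormP.
Qed.

Definition canon (x : X) : dual (dual X) := Dual (eval_at_dual x).

Definition reflexive_space : Prop := range canon = [set: dual (dual X)].

Definition annihilator (J : set X) : set (dual X) :=
  [set f | forall x, J x -> f x = 0].

Definition linear_subspace (J : set X) : Prop :=
  J 0 /\ forall (a : R[i]) x y, J x -> J y -> J (a *: x + y).

End Bidual.

Section OneSidedMIdeals.
Context (R : realType).

(* Norm of M_n(C_2(X)): a pair (x, y) stands for the column [x; y], i.e. for   *)
(* the matrix [x 0; y 0] of M_2(X), and M_n(M_2(X)) is identified with         *)
(* M_2n(X) by the canonical shuffle, which is isometric by [mnorm_scale].      *)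
Definition C2_mnorm (X : operatorSpaceType R) (n : nat) (z : 'M[X * X]_n) : R :=
  mnorm (block_mx (map_mx fst z) 0 (map_mx snd z) 0).

Definition complete_left_M_projection (X : operatorSpaceType R)
    (P : {linear X -> X}) : Prop :=
  (forall x, P (P x) = P x) /\
  forall n (x : 'M[X]_n),
    C2_mnorm (map_mx (fun x => (P x, x - P x)) x) = mnorm x.

Definition right_M_summand (X : operatorSpaceType R) (J : set X) : Prop :=
  exists P : {linear X -> X}, complete_left_M_projection P /\ J = range P.

Definition right_M_ideal (X : operatorSpaceType R) (J : set X) : Prop :=
  [/\ linear_subspace J, closed J &
      right_M_summand (X := dual (dual X)) (annihilator (annihilator J))].

Definition right_M_embedded (X : operatorSpaceType R) : Prop :=
  right_M_ideal (X := dual (dual X)) (range (@canon R X)).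

End OneSidedMIdeals.

Section Subspaces.
Context (R : realType) (X : normedModType R[i]).

Record subsp := Subsp {
  subsp_set : set X ;
  subsp_linear : linear_subspace subsp_set }.

Definition subsp_pred (Y : subsp) : {pred X} := fun x => `[< subsp_set Y x >].

Lemma subsp_submod_closed (Y : subsp) : submod_closed (subsp_pred Y).
Proof.
case: Y => S [S0 SD]; split; first exact/asboolP.
by move=> a x y /asboolP Sx /asboolP Sy; apply/asboolP; apply: (SD a x y).
Qed.

HB.instance Definition _ (Y : subsp) :=
  GRing.isSubmodClosed.Build R[i] X (subsp_pred Y) (subsp_submod_closed Y).

Record subsp_type (Y : subsp) := SubspElt {
  subsp_val :> X ;
  _ : subsp_val \in subsp_pred Y }.

Section Instances.
Variable Y : subsp.

HB.instance Definition _ := [isSub for @subsp_val Y].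
HB.instance Definition _ := [Choice of subsp_type Y by <:].
HB.instance Definition _ := [SubChoice_isSubLmodule of subsp_type Y by <:].

Let subsp_norm (y : subsp_type Y) : R[i] := `|subsp_val y|.

Let subsp_ler_normD (y z : subsp_type Y) :
  subsp_norm (y + z) <= subsp_norm y + subsp_norm z.
Proof. exact: ler_normD. Qed.

Let subsp_normrZ (a : R[i]) (y : subsp_type Y) :
  subsp_norm (a *: y) = `|a| * subsp_norm y.
Proof. exact: normrZ. Qed.

Let subsp_norm0_eq0 (y : subsp_type Y) : subsp_norm y = 0 -> y = 0.
Proof. by move=> /normr0_eq0 y0; apply: val_inj. Qed.

HB.instance Definition _ := Lmodule_isNormed.Build R[i] (subsp_type Y)
  subsp_ler_normD subsp_normrZ subsp_norm0_eq0.

End Instances.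
End Subspaces.

(* [D] is a dense set of least cardinality, i.e. of cardinality dens(T). *)
Definition min_dense (T : topologicalType) (D : set T) : Prop :=
  dense D /\ forall E : set T, dense E -> (D #<= E)%card.

Definition dens_eq (T U : topologicalType) : Prop :=
  exists (D : set T) (E : set U),
    [/\ min_dense D, min_dense E & (D #= E)%card].

Definition separable (T : topologicalType) : Prop :=
  exists D : set T, countable D /\ dense D.

Definition asplund (R : realType) (X : normedModType R[i]) : Prop :=
  forall Y : subsp X,
    separable (subsp_type Y) -> separable (dual (subsp_type Y)).

Section VectorIntegration.
Context (R : realType) (V : normedModType R[i]).
Context (d : measure_display) (T : measurableType d).
Implicit Types (mu : {finite_measure set T -> \bar R}) (G : set T -> V).

Definition vsimple (s : T -> V) : Prop :=
  finite_set (range s) /\ forall v, measurable (s @^-1` [set v]).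

Definition vsimple_integral mu (s : T -> V) (E : set T) : V :=
  \sum_(v \in range s) (fine (mu (E `&` s @^-1` [set v])))%:C *: v.

Definition strongly_measurable mu (g : T -> V) : Prop :=
  exists s : nat -> T -> V, (forall n, vsimple (s n)) /\
    {ae mu, forall t, s n t @[n --> \oo] --> g t}.

(* [g] is Bochner integrable over [E] with integral [I]. *)
Definition bochner_integral mu (g : T -> V) (E : set T) (I : V) : Prop :=
  strongly_measurable mu g /\
  exists s : nat -> T -> V, [/\ forall n, vsimple (s n),
    (\int[mu]_(t in E) (rnorm (g t - s n t))%:E)%E @[n --> \oo] --> 0%E &
    vsimple_integral mu (s n) E @[n --> \oo] --> I].

Definition vector_measure G : Prop :=
  forall F : nat -> set T, (forall n, measurable (F n)) -> trivIset setT F ->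
    \sum_(0 <= k < n) G (F k) @[n --> \oo] --> G (\bigcup_n F n).

Definition bounded_variation_measure G : Prop :=
  exists M : R, forall n (F : 'I_n -> set T),
    (forall i, measurable (F i)) -> trivIset setT F ->
    \sum_(i < n) rnorm (G (F i)) <= M.

Definition abs_continuous mu G : Prop :=
  forall A, measurable A -> mu A = 0%E -> G A = 0.

End VectorIntegration.

Definition radon_nikodym_property (R : realType) (V : normedModType R[i]) : Prop :=
  forall (d : measure_display) (T : measurableType d)
    (mu : {finite_measure set T -> \bar R}) (G : set T -> V),
  vector_measure G -> bounded_variation_measure G -> abs_continuous mu G ->
  exists g : T -> V,
    forall E, measurable E -> bochner_integral mu g E (G E).

(* Main.v *)
(* Let [P] be the left M-projection of the fourth dual of [X] onto the bipolar of
   [X]. If [P a = a] and [P b = 0] then [|a + b|^2 <= |a|^2 + |b|^2], as [|a + b|]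
   is the norm of the column of [a] and [b]; hence evaluation at [f] is the only
   norm preserving extension of [f : dual X] to the bidual of [X]. This implies
   that, for any subspace [Y] of [X], a subspace of [dual Y] which norms [Y] is
   dense. Taking the span of functionals norming the points of a dense subset of
   [Y] bounds the density character of [dual Y] by that of [Y]; the other
   inequality holds in every normed space.

   For the Radon-Nikodym property, a vector measure of bounded variation
   oscillates little on pieces exhausting the space: otherwise a dyadic tree of
   pieces yields a separable [Y] whose dual is not separable. The constants
   attached to finer and finer such partitions converge to the density. *)

From mathcomp Require Import all_boot all_order all_algebra.
From mathcomp Require Import complex.
From mathcomp Require Import all_classical all_reals all_analysis.
From mathcomp Require Import measurable_realfun ring lra.
Require Import Defs.

Set Implicit Arguments.
Unset Strict Implicit.
Unset Printing Implicit Defensive.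

Import Order.TTheory GRing.Theory Num.Theory.
Import numFieldNormedType.Exports.

Local Open Scope classical_set_scope.
Local Open Scope ring_scope.
Local Open Scope complex_scope.

(** * Hahn-Banach extension *)

(** Uniqueness of norm preserving extensions is all that is kept of the operator space structure;
    the rest is Banach space theory. The scalars being complex, functionals are built and compared
    through their real parts. Cardinals are compared through lists: the rational part of a dense
    span is an image of the lists over its index set, and over an infinite set lists are no more
    numerous than elements. This rests on an injection of [T * T] into [T], obtained by Zorn's lemma
    on graphs. The Radon-Nikodym part is Stegall's theorem; the branch of the tree is chosen
    diagonally against a dense sequence of the separable dual, which spares the comparison of
    uncountably many branches. Partitions of different accuracy are found independently and need not
    be nested; only their null intersections are discarded. *)

(** In the union of a chain any two points lie in one member, so a property that can be checked on
    two points at a time passes to the union. Adding [S0] to every member of [P] makes the empty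
    chain harmless and keeps the maximal set above [S0]. *)
Lemma Zorn_above T (good : set (set T)) (S0 : set T) :
  good S0 -> S0 !=set0 ->
  (forall W, W !=set0 -> (forall p q, W p -> W q ->
     exists Z, [/\ good Z, Z `<=` W, Z p & Z q]) -> good W) ->
  exists S, [/\ good S, S0 `<=` S &
    forall S', good S' -> S `<=` S' -> S' `<=` S].
Proof.
move=> gS0 S0n two; pose P := [set S | good (S `|` S0)].
have [F FP Ftot|S [PS Smax]] := @Zorn_bigcup _ P.
  apply: two => [|p q].
    by have [p S0p] := S0n; exists p; right.
  have inW X : F X -> X `|` S0 `<=` \bigcup_(X in F) X `|` S0.
    by move=> FX; apply: setSU; exact: bigcup_sup.
  move=> [[X FX Xp]|S0p] [[Y FY Yq]|S0q].
  - have [XY|YX] := Ftot _ _ FX FY.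
      by exists (Y `|` S0); split; [exact: FP|exact: inW|left; exact: XY|left].
    by exists (X `|` S0); split; [exact: FP|exact: inW|left|left; exact: YX].
  - by exists (X `|` S0); split; [exact: FP|exact: inW|left|right].
  - by exists (Y `|` S0); split; [exact: FP|exact: inW|right|left].
  - by exists S0; split => //; right.
have S0S : S0 `<=` S.
  move=> p S0p; apply: contrapT => Sp.
  apply: (Smax (S `|` S0)); last by rewrite /P/= -setUA setUid.
  by split; [left|move=> /(_ p) h; apply: Sp; apply: h; right].
exists S; split=> //; first by move: PS; rewrite /P/= setUidl.
move=> S' gS' SS'; apply: contrapT => h; apply: (Smax S'); first by split.
by rewrite /P/= setUidl//; exact: subset_trans SS'.
Qed.

Section RealPart.
Context (R : realType).
Local Notation C := R[i]^o.

Lemma Re_le_rnorm (w : C) : complex.Re w <= rnorm w.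
Proof.
rewrite -lecR -rnormE; apply: le_trans (normc_ge_Re w).
by rewrite lecR ler_norm.
Qed.

Lemma rotation (w : C) : exists2 z : C, rnorm z = 1 & z * w = (rnorm w)%:C.
Proof.
have [->|w0] := eqVneq w 0.
  by exists 1; rewrite ?(rnorm_real (c := 1)) ?ler01// mulr0 rnorm0.
have nw0 : rnorm w != 0 by apply: contra_neq w0 => /rnorm_eq0.
exists ((rnorm w)%:C / w).
  apply: (mulIf nw0); rewrite mul1r -rnormM divfK//.
  by rewrite rnorm_real// rnorm_ge0.
by rewrite divfK.
Qed.

(** The Bohnenblust-Sobczyk formula F v = f v - i f(i v). The bound survives because a unimodular
    [z] makes F(z v) real and equal to the modulus of F v, and there F agrees with [f]. *)
Lemma complexification (V : normedModType R[i]) (f : V -> R) (c : R) : 0 <= c ->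
  (forall v, f v <= c * rnorm v) ->
  (forall (t : R) v w, f (v + t%:C *: w) = f v + t * f w) ->
  exists2 F : dual V, dnorm F <= c & forall v, complex.Re (F v) = f v.
Proof.
move=> c0 fc flin.
have f0 : f 0 = 0.
  by have := flin (-1) 0 0; rewrite rmorphN1 scaler0 addr0 mulN1r subrr.
have fD v w : f (v + w) = f v + f w.
  by have := flin 1 v w; rewrite scale1r mul1r.
have fZ (t : R) v : f (t%:C *: v) = t * f v.
  by have := flin t 0 v; rewrite !add0r f0 add0r.
have fN v : f (- v) = - f v by rewrite -mulN1r -fZ rmorphN1 scaleN1r.
pose F v : C := (f v +i* - f ('i *: v))%C.
have Flin : linear F.
  have FD v w : F (v + w) = F v + F w.
    by rewrite /F scalerDr !fD opprD.
  have FZ a v : F (a *: v) = a *: F v.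
    case: a => x y; rewrite -[_ *: F v]/((x +i* y)%C * F v).
    have e (w : V) : (x +i* y)%C *: w = x%:C *: w + y%:C *: ('i *: w).
      by rewrite scalerA -scalerDl; congr (_ *: _); simpc.
    rewrite /F scalerA [_ * (x +i* y)%C]mulrC -scalerA !e !fD !fZ scalerA.
    have -> : ('i * 'i = -1 :> R[i])%C by rewrite -expr2 sqr_i.
    by rewrite scaleN1r fN; apply/eqP; rewrite eq_complex/=; apply/andP; split; apply/eqP; ring.
  by move=> a v w; rewrite FD FZ.
have Fc v : rnorm (F v) <= c * rnorm v.
  have [z z1 zF] := rotation (F v).
  have FZ : F (z *: v) = z * F v.
    have F0 : F 0 = 0 by rewrite /F scaler0 f0 oppr0.
    by have := Flin z v 0; rewrite !addr0 F0 addr0.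
  have -> : rnorm (F v) = f (z *: v).
    by have := congr1 (@complex.Re R) zF; rewrite -FZ /=.
  by rewrite (le_trans (fc _))// rnormZ z1 mul1r.
by exists (Dual (bounded_dual_pred Flin Fc)) => //; exact: dnorm_le.
Qed.

Lemma Re_inj_linear (U : lmodType R[i]) (phi psi : U -> C) :
  linear phi -> linear psi ->
  (forall u, complex.Re (phi u) = complex.Re (psi u)) -> phi =1 psi.
Proof.
have key (f : U -> C) u : linear f -> complex.Im (f u) = - complex.Re (f ('i%C *: u)).
  move=> flin; have f0 : f 0 = 0.
    by have := flin (-1) 0 0; rewrite scaler0 addr0 scaleN1r addNr.
  have := flin 'i%C u 0; rewrite f0 !addr0 => ->.
  by rewrite -['i%C *: f u]/('i%C * f u); case: (f u) => a b /=; ring.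
move=> pl ql pq u; apply/eqP; rewrite eq_complex pq eqxx/=.
by rewrite !key// pq.
Qed.

End RealPart.

Section HahnBanach.
Context (R : realType) (V : normedModType R[i]).
Local Notation C := R[i]^o.
Variable c : R.
Hypothesis c0 : 0 <= c.

(** Graphs of real linear functionals dominated by the norm. Single-valuedness is not demanded: it
    follows from linearity and the domination at 0. *)
Let real_graph (S : set (V * R)) : Prop :=
  (forall (t : R) p q, S p -> S q -> S (p.1 + t%:C *: q.1, p.2 + t * q.2)) /\
  forall p, S p -> p.2 <= c * rnorm p.1.

Let extend (S : set (V * R)) (v : V) (a : R) : set (V * R) :=
  [set q | exists p t, S p /\ q = (p.1 + t%:C *: v, p.2 + t * a)].

Let graph_extension (S : set (V * R)) v : S !=set0 -> real_graph S ->
  exists a, real_graph (extend S v a).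
Proof.
move=> [p0 Sp0] [Slin Sdom].
(* Domination of the extension forces its value at [v] to lie between all p.2 - c |p.1 - v| and all
   c |q.1 + v| - q.2; the least such value is chosen. *)
pose L := [set p.2 - c * rnorm (p.1 - v) | p in S].
have Lub p q : S p -> S q -> p.2 - c * rnorm (p.1 - v) <= c * rnorm (q.1 + v) - q.2.
  move=> Sp Sq; have := Sdom _ (Slin 1 _ _ Sp Sq); rewrite /= scale1r mul1r => h.
  have : rnorm (p.1 + q.1) <= rnorm (p.1 - v) + rnorm (q.1 + v).
    by rewrite (le_trans _ (rnormD _ _))// addrACA addNr addr0.
  move=> /(ler_wpM2l c0); lra.
have Lsup : has_sup L.
  split; first by exists (p0.2 - c * rnorm (p0.1 - v)), p0.
  by exists (c * rnorm (p0.1 + v) - p0.2) => _ [p Sp <-]; exact: Lub.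
have La p : S p -> p.2 - c * rnorm (p.1 - v) <= sup L.
  by move=> Sp; apply: ub_le_sup; [exact: Lsup.2|exists p].
have aL p : S p -> sup L <= c * rnorm (p.1 + v) - p.2.
  by move=> Sp; apply: ge_sup; [exact: Lsup.1|move=> _ [q Sq <-]; exact: Lub].
exists (sup L); split.
  move=> t _ _ [p [r [Sp ->]]] [q [s [Sq ->]]] /=.
  exists (p.1 + t%:C *: q.1, p.2 + t * q.2), (r + t * s); split; first exact: Slin.
  congr pair; last by rewrite /=; ring.
  by rewrite /= rmorphD rmorphM scalerDl scalerDr scalerA addrACA.
move=> _ [p [t [Sp ->]]] /=.
have S0 : S (0, 0).
  have := Slin (-1) _ _ Sp Sp.
  by rewrite rmorphN1 scaleN1r mulN1r !subrr.
have Ssc r q : S q -> S (r%:C *: q.1, r * q.2).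
  by move=> Sq; have := Slin r _ _ S0 Sq; rewrite /= !add0r.
have nr r (x : V) : 0 <= r -> rnorm (r%:C *: x) = r * rnorm x.
  by move=> r0; rewrite rnormZ rnorm_real.
have [t0|t0|<-] := ltgtP 0 t.
- have := aL _ (Ssc t^-1 _ Sp); rewrite /= => h.
  have e : p.1 + t%:C *: v = t%:C *: (t^-1%:C *: p.1 + v).
    by rewrite scalerDr scalerA -rmorphM/= mulfV ?gt_eqF// scale1r.
  rewrite e nr; last exact: ltW.
  move: h; rewrite -(ler_pM2l t0) mulrBr mulVKf ?gt_eqF//. lra.
- have tN0 : 0 < - t by rewrite oppr_gt0.
  have := La _ (Ssc (- t)^-1 _ Sp); rewrite /= => h.
  have e : p.1 + t%:C *: v = (- t)%:C *: ((- t)^-1%:C *: p.1 - v).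
    rewrite scalerBr scalerA -rmorphM/= mulfV ?gt_eqF// scale1r.
    by rewrite rmorphN scaleNr opprK.
  rewrite e nr; last exact: ltW.
  move: h.
  rewrite -(ler_pM2l tN0) mulrBr mulVKf ?gt_eqF//. lra.
- by rewrite scale0r mul0r !addr0; exact: Sdom.
Qed.

Let maximal_graph (S0 : set (V * R)) : S0 !=set0 -> real_graph S0 ->
  exists f : V -> R, [/\ forall v, f v <= c * rnorm v,
    forall (t : R) v w, f (v + t%:C *: w) = f v + t * f w &
    forall p, S0 p -> f p.1 = p.2].
Proof.
move=> [p0 S0p0] gS0.
have [||S [gS S0S Smax]] := @Zorn_above _ real_graph S0 gS0.
- by exists p0.
- move=> W _ two; split.
    move=> t p q Wp Wq; have [Z [[Zlin _] ZW Zp Zq]] := two _ _ Wp Wq.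
    by apply: ZW; exact: Zlin.
  by move=> p Wp; have [Z [[_ Zdom] _ Zp _]] := two _ _ Wp Wp; exact: Zdom.
have Stot v : exists r, S (v, r).
  have [|a gE] := @graph_extension S v _ gS; first by exists p0; exact: S0S.
  have SE : S `<=` extend S v a.
    move=> p Sp; exists p, 0; split=> //.
    by rewrite scale0r mul0r !addr0; case: p {Sp}.
  have ES : extend S v a `<=` S by exact: Smax.
  have Sz : S (0, 0).
    have := gS.1 (-1) _ _ (S0S _ S0p0) (S0S _ S0p0).
    by rewrite rmorphN1 scaleN1r mulN1r !subrr.
  exists a; apply: ES; exists (0, 0), 1; split=> //.
  by rewrite scale1r mul1r !add0r.
have Sfun v r s : S (v, r) -> S (v, s) -> r = s.
  move=> Sr Ss; apply/eqP; rewrite -subr_eq0 eq_le.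
  have h x y : S (v, x) -> S (v, y) -> x - y <= 0.
    move=> Sx Sy; have := gS.2 _ (gS.1 (-1) _ _ Sx Sy) => /=.
    by rewrite rmorphN1 scaleN1r mulN1r !subrr rnorm0 mulr0.
  by rewrite h//= -opprB oppr_ge0 h.
pose f v := sval (cid (Stot v)).
have Sf v : S (v, f v) by rewrite /f; case: cid.
exists f; split=> [v|t v w|p S0p].
- exact: (gS.2 _ (Sf v)).
- exact: (Sfun _ _ _ (Sf _) (gS.1 t _ _ (Sf v) (Sf w))).
- by apply: (Sfun p.1); [exact: Sf|apply: S0S; rewrite -surjective_pairing].
Qed.

(** The map [j] need not be injective, since the bound makes [psi] vanish on its kernel. So [U] may
    be an external sum such as [subsp_type Y * C], without a check that its image is a direct
    sum. *)
Theorem hahn_banach (U : lmodType R[i]) (j : U -> V) (psi : U -> C) :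
  linear j -> linear psi -> (forall u, rnorm (psi u) <= c * rnorm (j u)) ->
  exists F : dual V, (forall u, F (j u) = psi u) /\ dnorm F <= c.
Proof.
move=> jlin plin pj.
have [||f [fc flin fS]] := @maximal_graph [set (j u, complex.Re (psi u)) | u in setT].
- by exists (j 0, complex.Re (psi 0)); exists 0.
- split=> [t _ _ [u _ <-] [v _ <-]|_ [u _ <-]] /=.
    exists (t%:C *: v + u) => //; rewrite jlin plin addrC; congr pair.
    rewrite addrC raddfD/=; congr (_ + _).
    by rewrite -[t%:C *: psi v]/(t%:C * psi v); case: (psi v) => a b /=; ring.
  by rewrite (le_trans (Re_le_rnorm _)).
have [F Fc Ff] := complexification c0 fc flin.
exists F; split=> //; apply: Re_inj_linear => // [a u v|u].
  by rewrite jlin linearP.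
by rewrite Ff (fS (j u, complex.Re (psi u))); last by exists u.
Qed.

End HahnBanach.

(** * One-sided M-ideals and norm preserving extensions *)

Section Column.
Context (R : realType) (W : operatorSpaceType R).

Lemma opnorm_id n : opnorm (fun i j => (1%:M : 'M[R[i]]_n) i j) <= 1.
Proof.
apply: opnorm_le => // u v; rewrite mul1r bilE.
rewrite (_ : \sum_i _ = \sum_i u i * v i) ?l2norm_dot//.
apply: eq_bigr => i _; congr (_ * _).
rewrite (bigD1 i)//= mxE eqxx mul1r big1 ?addr0// => j ji.
by rewrite mxE eq_sym (negbTE ji) mul0r.
Qed.

(** The column factors as diag(a', b') times a scalar column with entries |a| and |b|, where a' and
    b' lie in the unit ball. The diagonal has norm at most 1 and the scalar column has the Euclidean
    norm. *)
Lemma mnorm_column (a b : W) :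
  mnorm (block_mx (const_mx a : 'M[W]_1) 0 (const_mx b) (0 : 'M[W]_1)) ^+ 2 <=
  rnorm a ^+ 2 + rnorm b ^+ 2.
Proof.
have unit_scale (x : W) : exists2 y, rnorm y <= 1 & x = (rnorm x)%:C *: y.
  have [->|x0] := eqVneq x 0.
    by exists 0; rewrite ?rnorm0 ?scaler0 ?ler01.
  have nx0 : rnorm x != 0 by apply: contra_neq x0 => /rnorm_eq0.
  exists ((rnorm x)^-1%:C *: x).
    by rewrite rnormZ rnorm_real ?invr_ge0 ?rnorm_ge0// mulVf.
  by rewrite scalerA -rmorphM/= mulfV// scale1r.
have [a' a'1 aE] := unit_scale a; have [b' b'1 bE] := unit_scale b.
pose alpha := (rnorm a)%:C; pose beta := (rnorm b)%:C.
pose B : 'M[R[i]]_(1 + 1) := block_mx (const_mx alpha) 0 (const_mx beta) 0.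
pose D := block_mx (const_mx a' : 'M[W]_1) 0 0 (const_mx b' : 'M[W]_1).
have -> : block_mx (const_mx a : 'M[W]_1) 0 (const_mx b) (0 : 'M[W]_1) =
    mxscale (1%:M : 'M[R[i]]_(1 + 1)) D B.
  apply/matrixP => i j; rewrite [RHS]mxE (bigD1 i)//= [X in _ + X]big1 ?addr0; last first.
    move=> k ki; rewrite big1// => l _.
    by rewrite mxE eq_sym (negbTE ki) mul0r scale0r.
  rewrite [in RHS]mxE eqxx; under [RHS]eq_bigr do rewrite mul1r.
  rewrite big_split_ord/= !big_ord1.
  have [i' ->|i' ->] := split_ordP i; have [j' ->|j' ->] := split_ordP j;
    rewrite !(block_mxEul, block_mxEur, block_mxEdl, block_mxEdr) !mxE
      ?(scaler0, scale0r, addr0, add0r)//.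
have opB : opnorm (fun i j => B i j) <= Num.sqrt (rnorm a ^+ 2 + rnorm b ^+ 2).
  apply: opnorm_le => [|u v]; first exact: sqrtr_ge0.
  have -> : bil (fun i j => B i j) u v =
      (\sum_i B i (lshift 1 ord0) * u i) * v (lshift 1 ord0).
    rewrite bilEr big_split_ord/= !big_ord1 [X in _ + X]mulrC.
    rewrite [X in _ + _ * X]big1 ?mulr0 ?addr0; last first.
      move=> i _; have [i' ->|i' ->] := split_ordP i;
      by rewrite !(block_mxEur, block_mxEdr) mxE mulr0.
    by congr (_ * _); apply: eq_bigr => i _; rewrite mulrC.
  rewrite rnormM ler_pM ?rnorm_ge0 ?l2norm_coord//.
  rewrite (le_trans (l2norm_dot _ _))// ler_wpM2r ?l2norm_ge0// /l2norm.
  rewrite big_split_ord/= !big_ord1 block_mxEul block_mxEdl !mxE.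
  by rewrite !rnorm_real ?rnorm_ge0.
have D1 : mnorm D <= 1.
  rewrite (mnorm_block _ _ (const_mx a' : 'M[W]_1) (const_mx b' : 'M[W]_1)).
  by rewrite !mnorm_mx11 ge_max a'1 b'1.
rewrite -[leRHS]sqr_sqrtr ?addr_ge0 ?sqr_ge0// ler_sqr ?nnegrE ?mnorm_ge0 ?sqrtr_ge0//.
rewrite (le_trans (mnorm_scale _ _ _ _ _))// -[leRHS]mul1r ler_pM ?opnorm_ge0//.
  by rewrite mulr_ge0 ?opnorm_ge0 ?mnorm_ge0.
by rewrite mulr_ile1 ?opnorm_ge0 ?mnorm_ge0 ?opnorm_id.
Qed.

Lemma M_projection_norm (P : {linear W -> W}) x : complete_left_M_projection P ->
  rnorm x ^+ 2 <= rnorm (P x) ^+ 2 + rnorm (x - P x) ^+ 2.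
Proof.
move=> [_ /(_ 1%N (const_mx x))]; rewrite mnorm_mx11 => <-.
rewrite (le_trans _ (mnorm_column _ _))// le_eqVlt; apply/orP; left; apply/eqP.
congr (_ ^+ 2); rewrite /C2_mnorm; congr mnorm.
by congr (block_mx _ _ _ _); apply/matrixP => i j; rewrite !mxE.
Qed.

End Column.

Section HahnBanachSmooth.
Context (R : realType).

Definition hahn_banach_smooth (X : normedModType R[i]) : Prop :=
  forall F : dual (dual (dual X)), forall f : dual X,
    (forall x, F (canon x) = f x) -> dnorm F <= dnorm f -> F = canon f.

Lemma dnorm_canon (X : normedModType R[i]) (x : X) : dnorm (canon x) <= rnorm x.
Proof.
apply: dnorm_le => [|f]; first exact: rnorm_ge0.
by rewrite mulrC -[canon x f]/(f x) dnormP.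
Qed.

(** A gain linear in t cannot stay below a quadratic one: sqrt(1 + s) <= 1 + s leaves y <= N B^2 t,
    which fails at t = y / (N B^2 + 1) if y > 0. *)
Lemma linear_le_sqrt (N B y : R) : 0 <= N -> 0 <= y ->
  (forall t, 0 < t -> N + t * y <= N * Num.sqrt (1 + t ^+ 2 * B ^+ 2)) -> y = 0.
Proof.
move=> N0 y0 h; apply/eqP; rewrite eq_le y0 andbT leNgt; apply/negP => ypos.
have sq t : Num.sqrt (1 + t ^+ 2 * B ^+ 2) <= 1 + t ^+ 2 * B ^+ 2.
  have z0 : 0 <= t ^+ 2 * B ^+ 2 by rewrite mulr_ge0 ?sqr_ge0.
  rewrite -[leRHS]ger0_norm ?addr_ge0// -sqrtr_sqr ler_wsqrtr//.
  by rewrite expr2 ler_peMl ?addr_ge0 ?lerDl.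
pose M := N * B ^+ 2 + 1; have M0 : 0 < M by rewrite ltr_pwDr// mulr_ge0 ?sqr_ge0.
have t0 : 0 < y / M by rewrite divr_gt0.
have := le_trans (h _ t0) (ler_wpM2l N0 (sq _)).
have e : y = y / M * M by rewrite divfK ?gt_eqF.
move: t0 e; set t := y / M => t0 e.
have -> : t * y = N * (t ^+ 2 * B ^+ 2) + t * t by rewrite e /M; ring.
suff : ~ (t * t <= 0) by lra.
by rewrite leNgt mulr_gt0.
Qed.

(* Elements of [ker P] vanish on norm preserving extensions: otherwise a small *)
(* multiple of one, added to a norming element of [range P], would increase   *)
(* the value to first order but the norm only to second order.               *)
Lemma M_embedded_smooth (X : operatorSpaceType R) :
  right_M_embedded X -> hahn_banach_smooth X.
Proof.
move=> [_ _ [P [MP rP]]] F f Ff Fle.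
have kill (G : dual (dual (dual X))) b : (forall x, G (canon x) = f x) ->
    dnorm G <= dnorm f -> P b = 0 -> b G = 0.
  move=> Gf Gle Pb.
  have [z z1 zb] := rotation (b G).
  suff : rnorm (b G) = 0 by move=> /rnorm_eq0.
  apply: (@linear_le_sqrt (dnorm f) (rnorm b)) => [||t t0]; rewrite ?dnorm_ge0 ?rnorm_ge0//.
  (* [dnorm f] is a supremum, so it suffices to bound |f x| + t |b G| for each [x] in the unit ball;
     phases [z] and [z'] turn this sum into one value of [G]. *)
  rewrite -lerBrDr; apply: ge_sup; first exact: (dnorm_has_sup f).1.
  move=> _ [x /= x1 <-]; rewrite lerBrDr.
  have [z' z'1 z'f] := rotation (f x).
  pose a := canon (canon (z' *: x)).
  have Ra : range P a.
    by rewrite -rP => g gJ; apply: gJ; exists (z' *: x).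
  have Pa : P a = a by case: Ra => w _ <-; rewrite MP.1.
  have a1 : rnorm a <= 1.
    rewrite (le_trans (dnorm_canon _))// (le_trans (dnorm_canon _))//.
    by rewrite rnormZ z'1 mul1r.
  pose w := (t%:C * z) *: b + a.
  have Pw : P w = a by rewrite linearD linearZ/= Pb scaler0 add0r.
  have := M_projection_norm w MP; rewrite Pw addrK.
  rewrite rnormZ rnormM z1 mulr1 (rnorm_real (ltW t0)) exprMn => wle.
  have -> : rnorm (f x) + t * rnorm (b G) = complex.Re (w G).
    rewrite -[w G]/((t%:C * z) * b G + G (canon (z' *: x))) -mulrA zb Gf.
    by rewrite linearZ/= -[z' *: f x]/(z' * f x) z'f /= mul0r subr0 addrC.
  rewrite (le_trans (Re_le_rnorm _))// (le_trans (dnormP _ _))// mulrC.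
  rewrite ler_pM ?dnorm_ge0//.
  rewrite -[leLHS]ger0_norm ?dnorm_ge0// -sqrtr_sqr ler_wsqrtr//.
  rewrite (le_trans wle)// lerD2r exprn_ile1 ?rnorm_ge0//.
(* Both [F] and [canon f] are killed by w - P w, so their values at [e] are read off from [P w].
   This lies in the bipolar of X, while F - canon f annihilates X. *)
apply: dualP => e; pose w := canon e.
have wP (G : dual (dual (dual X))) : (forall x, G (canon x) = f x) ->
    dnorm G <= dnorm f -> G e = P w G.
  have kP : P (w - P w) = 0 by rewrite linearB/= MP.1 subrr.
  move=> Gf Gle; apply/eqP; rewrite -subr_eq0; apply/eqP.
  exact: (kill G _ Gf Gle kP).
have fle : dnorm (canon f) <= dnorm f by exact: dnorm_canon.
rewrite wP// (wP (canon f))//; apply/eqP; rewrite -subr_eq0 -linearB; apply/eqP.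
have : range P (P w) by exists w.
by rewrite -rP; apply => _ [x _ <-]; rewrite -[LHS]/(F (canon x) - f x) Ff subrr.
Qed.

End HahnBanachSmooth.

(** * Norming subspaces of the dual *)

Section Density.
Context (R : realType).
Local Notation C := R[i]^o.

Lemma denseP (V : normedModType R[i]) (S : set V) :
  dense S <-> forall x (e : R), 0 < e -> exists2 s, S s & rnorm (x - s) < e.
Proof.
split=> [dS x e e0|h O [x Ox] oO].
  have [||s [xs Ss]] := dS (ball x e%:C)°.
  - by exists x; apply: nbhsx_ballx; rewrite ltcR.
  - exact: open_interior.
  exists s => //; move: (interior_subset xs); rewrite -ball_normE /=.
  by rewrite rnormE ltcR.
have /nbhs_ballP[e /= e0 xeO] : nbhs x O by exact: open_nbhs_nbhs.
have eE : e = (complex.Re e)%:C by rewrite RRe_real// gtr0_real.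
have [|s Ss xs] := h x (complex.Re e); first by rewrite -ltcR -eE.
exists s; split=> //; apply: xeO; rewrite -ball_normE/= eE.
by rewrite rnormE ltcR.
Qed.

Context (V : normedModType R[i]).

Definition lin_span (I : Type) (n : I -> V) : set V :=
  [set v | exists s : seq (R[i] * I), v = \sum_(p <- s) p.1 *: n p.2].

Lemma lin_span_subspace (I : Type) (n : I -> V) : linear_subspace (lin_span n).
Proof.
split; first by exists [::]; rewrite big_nil.
move=> a _ _ [s ->] [t ->].
exists ([seq (a * p.1, p.2) | p <- s] ++ t).
rewrite big_cat big_map/=; congr (_ + _).
by rewrite scaler_sumr; apply: eq_bigr => p _; rewrite scalerA.
Qed.

Lemma lin_span_mem (I : Type) (n : I -> V) i : lin_span n (n i).
Proof. by exists [:: (1, i)]; rewrite big_seq1 scale1r. Qed.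

Definition complex_of_rat2 (q : rat * rat) : R[i] := (ratr q.1 +i* ratr q.2)%C.

Lemma complex_of_rat2_dense (a : R[i]) (e : R) : 0 < e ->
  exists q, rnorm (a - complex_of_rat2 q : C) < e.
Proof.
move=> e0; have e2 : 0 < e / 2 by rewrite divr_gt0.
have h (x : R) : exists q, `|x - ratr q| < e / 2.
  have [|q] := @rat_in_itvoo R (x - e / 2) (x + e / 2).
    by rewrite ltrD2l gt0_cp.
  rewrite in_itv/= => /andP[q1 q2]; exists q.
  by rewrite ltr_distlC q1 q2.
case: a => x y; have [p xp] := h x; have [q yq] := h y.
exists (p, q).
have -> : (x +i* y)%C - complex_of_rat2 (p, q) =
    (x - ratr p)%:C + 'i%C * (y - ratr q)%:C :> C.
  by apply/eqP; rewrite eq_complex/=; apply/andP; split; apply/eqP; ring.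
have nc (r : R) : rnorm (r%:C : C) = `|r|.
  by rewrite /rnorm normc_def/= expr0n/= addr0 sqrtr_sqr.
rewrite (le_lt_trans (rnormD _ _))// rnormM !nc.
have -> : rnorm ('i%C : C) = 1.
  by rewrite /rnorm normc_def/= expr0n/= add0r expr1n sqrtr1.
lra.
Qed.

(** Written as an image of lists, so that its cardinality is bounded by theirs. *)
Definition rat_span (I : Type) (n : I -> V) : set V :=
  range (fun s : seq ((rat * rat) * I) => \sum_(p <- s) complex_of_rat2 p.1 *: n p.2).

Lemma rat_span_dense (I : Type) (n : I -> V) : dense (lin_span n) -> dense (rat_span n).
Proof.
move=> /denseP ds; apply/denseP => x e e0.
have e2 : 0 < e / 2 by rewrite divr_gt0.
suff approx (s : seq (R[i] * I)) d : 0 < d -> exists2 v, rat_span n v &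
    rnorm (\sum_(p <- s) p.1 *: n p.2 - v) < d.
  have [_ [s ->] xs] := ds x _ e2; have [v nv sv] := approx s _ e2.
  exists v => //; rewrite -(subrKA (\sum_(p <- s) p.1 *: n p.2)).
  by rewrite (le_lt_trans (rnormD _ _))//; lra.
elim: s d => [d d0|[a i] s IH d d0].
  exists 0; first by exists [::]; rewrite ?big_nil.
  by rewrite big_nil subrr rnorm0.
have d2 : 0 < d / 2 by rewrite divr_gt0.
have [_ [t _ <-] st] := IH _ d2.
have M0 : 0 < rnorm (n i) + 1 by rewrite ltr_wpDl ?rnorm_ge0.
have [q aq] := complex_of_rat2_dense a (divr_gt0 d2 M0).
exists (\sum_(p <- (q, i) :: t) complex_of_rat2 p.1 *: n p.2); first by exists ((q, i) :: t).
rewrite !big_cons/= opprD addrACA -scalerBl (le_lt_trans (rnormD _ _))//.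
rewrite rnormZ [ltRHS](splitr d) ler_ltD//.
rewrite (@le_trans _ _ (d / 2 / (rnorm (n i) + 1) * (rnorm (n i) + 1)))//; last first.
  by rewrite divfK// gt_eqF.
by rewrite ler_pM ?rnorm_ge0// ?(ltW aq)// lerDl.
Qed.

(** On N + C x the functional n + a x |-> a has norm at most 1/e, because n + a x is a multiple by
    [a] of some x - n' with n' in [N]. *)
Lemma separation (N : set V) x (e : R) : linear_subspace N -> 0 < e ->
  (forall n, N n -> e <= rnorm (x - n)) ->
  exists phi : dual V, (forall n, N n -> phi n = 0) /\ phi x = 1.
Proof.
move=> Nlin e0 h; pose M := Subsp Nlin.
have MN (u : subsp_type M) : N (subsp_val u) by case: u => u /= /asboolP.
pose j (u : (subsp_type M * C)%type) : V := subsp_val u.1 + u.2 *: x.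
pose psi (u : (subsp_type M * C)%type) : C := u.2.
have [||//||phi [phij _]] := @hahn_banach R V e^-1 _ _ j psi.
- by rewrite invr_ge0 ltW.
- move=> a u v; rewrite /j/= scalerDr scalerDl !addrA; congr (_ + _).
  by rewrite -!addrA; congr (_ + _); rewrite addrC scalerA.
- move=> [u a]; rewrite /j /psi/=.
  have [->|a0] := eqVneq a 0.
    by rewrite rnorm0 mulr_ge0 ?rnorm_ge0// invr_ge0 ltW.
  rewrite mulrC ler_pdivlMr// mulrC.
  have -> : subsp_val u + a *: x = a *: (x - (- a^-1) *: subsp_val u).
    by rewrite scalerBr scalerA mulrN mulfV// scaleN1r opprK addrC.
  rewrite rnormZ mulrC ler_wpM2l ?rnorm_ge0// h//.
  by have := Nlin.2 (- a^-1) _ 0 (MN u) Nlin.1; rewrite addr0.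
exists phi; split=> [n Nn|].
  have nM : n \in subsp_pred M by exact/asboolP.
  by have := phij (SubspElt nM, 0); rewrite /j/= scale0r addr0.
by have := phij (0, 1); rewrite /j/= scale1r add0r.
Qed.

End Density.

Section DensityDual.
Context (R : realType).
Local Notation C := R[i]^o.

Lemma norming_functional (V : normedModType R[i]) (y : V) :
  exists2 f : dual V, dnorm f <= 1 & f y = (rnorm y)%:C.
Proof.
have [|||f [fy f1]] := @hahn_banach R V 1 ler01 C (fun a => a *: y)
    (fun a => a *: ((rnorm y)%:C : C)).
- by move=> a u v; rewrite scalerDl scalerA.
- by move=> a u v; rewrite scalerDl scalerA.
- by move=> a; rewrite mul1r !rnormZ rnorm_real ?rnorm_ge0.
by exists f => //; have := fy 1; rewrite !scale1r.
Qed.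

Variable X : normedModType R[i].

Definition restrict_fun (Y : subsp X) (f : dual X) : subsp_type Y -> C :=
  fun y => f (subsp_val y).

Lemma restrict_subproof (Y : subsp X) (f : dual X) :
  restrict_fun f \in dual_pred (X := subsp_type Y).
Proof.
apply: (@bounded_dual_pred _ _ _ (dnorm f)) => [a u v|u].
  by rewrite /restrict_fun linearP.
exact: dnormP.
Qed.

Definition restrict (Y : subsp X) (f : dual X) : dual (subsp_type Y) :=
  Dual (restrict_subproof Y f).

Lemma restrict_linear (Y : subsp X) (a : R[i]) (f g : dual X) :
  restrict Y (a *: f + g) = a *: restrict Y f + restrict Y g.
Proof. by apply: dualP. Qed.

Lemma dnorm_restrict (Y : subsp X) (f : dual X) : dnorm (restrict Y f) <= dnorm f.
Proof. by apply: dnorm_le => [|y]; [exact: dnorm_ge0|exact: (dnormP f)]. Qed.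

Lemma extension (Y : subsp X) (n : dual (subsp_type Y)) :
  exists2 f : dual X, restrict Y f = n & dnorm f <= dnorm n.
Proof.
have [|||f [fn fle]] := @hahn_banach R X (dnorm n) (dnorm_ge0 n) _
    (fun y : subsp_type Y => subsp_val y) n.
- by [].
- exact: dual_linear.
- by move=> y; exact: dnormP.
by exists f => //; apply: dualP => y; exact: fn.
Qed.

Lemma dual_comp_canon (F : dual (dual (dual X))) :
  (fun x => F (canon x)) \in dual_pred (X := X).
Proof.
apply: (@bounded_dual_pred _ _ _ (dnorm F)) => [a x y|x].
  have -> : canon (a *: x + y) = a *: canon x + canon y.
    by apply: dualP => f; rewrite -[LHS]/(f (a *: x + y)) linearP.
  by rewrite linearP.
by rewrite (le_trans (dnormP _ _))// ler_wpM2l ?dnorm_ge0// dnorm_canon.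
Qed.

(* If [N] were not dense, some [y2] in [dual (dual Y)] would kill [N] but not *)
(* [phi]. As [N] is norming, [y |-> phi y] has a norm preserving extension    *)
(* to the bidual of [X] killing [y2]; smoothness identifies it with           *)
(* evaluation at an extension of [phi], which does not kill [y2].             *)
Lemma smooth_norming_dense (Y : subsp X) (N : set (dual (subsp_type Y))) :
  hahn_banach_smooth X -> linear_subspace N ->
  (forall (y : subsp_type Y) (c : R),
    (forall n, N n -> dnorm n <= 1 -> rnorm (n y) <= c) -> rnorm y <= c) ->
  dense N.
Proof.
move=> Xs Nlin Nnorm; apply/denseP => phi e e0; apply: contrapT => h.
have [|y2 [y2N y2phi]] := @separation _ _ N phi e Nlin e0.
  move=> n Nn; rewrite leNgt; apply/negP => ne; apply: h; by exists n.
have wP : (fun f => y2 (restrict Y f)) \in dual_pred (X := dual X).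
  apply: (@bounded_dual_pred _ _ _ (dnorm y2)) => [a f g|f].
    by rewrite restrict_linear linearP.
  by rewrite (le_trans (dnormP _ _))// ler_wpM2l ?dnorm_ge0// dnorm_restrict.
pose w : dual (dual X) := Dual wP.
pose j (u : (subsp_type Y * C)%type) : dual (dual X) :=
  canon (subsp_val u.1) + u.2 *: w.
have jE u f : j u f = f (subsp_val u.1) + u.2 * y2 (restrict Y f) by [].
pose psi (u : (subsp_type Y * C)%type) : C := phi u.1.
have [|||F [Fj Fle]] := @hahn_banach R _ (dnorm phi) (dnorm_ge0 phi) _ j psi.
- move=> a u v; apply: dualP => f; rewrite -[RHS]/(a * j u f + j v f) !jE/=.
  by rewrite linearP/= -[a *: f _]/(a * f _) -[a *: u.2]/(a * u.2); ring.
- by move=> a u v; rewrite /psi/= linearP.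
(* Adding a multiple of [w] to a point of Y cannot decrease its norm: tested on extensions of
   elements of [N], the term in [w] vanishes, and [N] norms Y. *)
- move=> u; rewrite (le_trans (dnormP _ _))// ler_wpM2l ?dnorm_ge0//.
  apply: Nnorm => n Nn n1; have [f fn fle] := extension n.
  have <- : j u f = n u.1 by rewrite jE fn y2N// mulr0 addr0 -fn.
  rewrite (le_trans (dnormP _ _))// ler_piMr ?dnorm_ge0//.
  exact: le_trans fle n1.
pose f : dual X := Dual (dual_comp_canon F).
have fphi : restrict Y f = phi.
  apply: dualP => y; have := Fj (y, 0); rewrite /psi /= => <-.
  by rewrite /j/= scale0r addr0.
have Ff : F = canon f.
  apply: Xs => //; rewrite (le_trans Fle)// -fphi; exact: dnorm_restrict.
(* [F] vanishes at [w], since [psi] ignores the second coordinate; evaluation at [f] gives y2 phi =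
   1 there. *)
pose z : subsp_type Y := 0.
have : F (j (z, 1)) = phi z := Fj (z, 1).
rewrite Ff -[LHS]/(j (z, 1) f) jE fphi y2phi mulr1 !linear0 add0r => /eqP.
by rewrite oner_eq0.
Qed.

Lemma dense_dual_of_dense (Y : subsp X) (D : set (subsp_type Y)) :
  hahn_banach_smooth X -> dense D ->
  exists n : D -> dual (subsp_type Y), dense (rat_span n).
Proof.
move=> Xs /denseP dD.
have /choice[n nP] : forall d : D, exists f : dual (subsp_type Y),
    dnorm f <= 1 /\ f (set_val d) = (rnorm (set_val d))%:C.
  by move=> d; have [f f1 fd] := norming_functional (set_val d); exists f.
exists n; apply: rat_span_dense; apply: smooth_norming_dense => //.
  exact: lin_span_subspace.
move=> y c hc; apply/ler_addgt0Pr => e e0.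
(* Half of [e], as the error |y - d| is paid twice: from |y| to |d|, and from the value of the
   functional at [d] to that at [y]. *)
have [d Dd yd] := dD y _ (divr_gt0 e0 (ltr0Sn _ 1)).
have [n1 nd] := nP (SigSub (mem_set Dd)).
move: n1 nd; set nn := n _; rewrite /= => n1 nd.
have nyc := hc _ (lin_span_mem n _) n1; rewrite -/nn in nyc.
have : rnorm d <= rnorm (nn y) + rnorm (y - d).
  have -> : rnorm d = rnorm (nn d) by rewrite nd rnorm_real ?rnorm_ge0.
  have -> : nn d = nn y - nn (y - d) by rewrite linearB/= subKr.
  rewrite (le_trans (rnormD _ _))// lerD2l.
  have -> : rnorm (- nn (y - d)) = rnorm (nn (y - d)).
    by rewrite /rnorm normrN.
  rewrite (le_trans (dnormP _ _))// ler_piMl ?rnorm_ge0//.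
have : rnorm y <= rnorm d + rnorm (y - d).
  by rewrite (le_trans _ (rnormD _ _))// addrC subrK.
lra.
Qed.

(** Each functional in [E] gets a point of the unit ball where it reaches half its norm. If [phi]
    kills all these points and f in [E] is within d/3 of it, then |f| <= 2 |phi - f|, hence |phi| <=
    d; so [phi] is 0. *)
Lemma dense_of_dense_dual (E : set (dual X)) : dense E ->
  exists y : E -> X, dense (rat_span y).
Proof.
move=> /denseP dE.
have ex (e : E) : exists x, rnorm x <= 1 /\ dnorm (set_val e) <= 2 * rnorm (set_val e x).
  set f := set_val e; have [f0|f0] := eqVneq (dnorm f) 0.
    by exists 0; rewrite f0 rnorm0 mulr_ge0 ?rnorm_ge0.
  have fpos : 0 < dnorm f by rewrite lt_neqAle eq_sym f0 dnorm_ge0.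
  have /sup_adherent/(_ (dnorm_has_sup f))[_ [x /= x1 <-] fx] : 0 < dnorm f / 2.
    by rewrite divr_gt0.
  move: fx; rewrite -/(dnorm f) => fx; exists x; split=> //; lra.
have [y yP] := choice ex; exists y; apply: rat_span_dense.
apply/denseP => x e e0; apply: contrapT => h.
have [|phi [phiN phix]] := @separation _ _ (lin_span y) x e (lin_span_subspace y) e0.
  move=> n Nn; rewrite leNgt; apply/negP => ne; apply: h; by exists n.
have phi0 : dnorm phi = 0.
  apply/eqP; rewrite eq_le dnorm_ge0 andbT; apply/ler_addgt0Pr => d d0; rewrite add0r.
  have [f Ef phif] := dE phi _ (divr_gt0 d0 (ltr0Sn _ 2)).
  have [y1] := yP (SigSub (mem_set Ef)).
  set yf := y _; rewrite /= => fy.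
  have : rnorm (f yf) <= rnorm (phi - f).
    have -> : f yf = - (phi - f) yf.
      by rewrite -[(phi - f) yf]/(phi yf - f yf) phiN ?sub0r ?opprK//; exact: lin_span_mem.
    have -> : rnorm (- (phi - f) yf) = rnorm ((phi - f) yf) by rewrite /rnorm normrN.
    by rewrite (le_trans (dnormP _ _))// ler_piMr ?dnorm_ge0.
  have : dnorm phi <= dnorm f + rnorm (phi - f).
    rewrite -[dnorm phi]/(rnorm phi) -[dnorm f]/(rnorm f).
    by rewrite (le_trans _ (rnormD _ _))// addrC subrK.
  lra.
have := dnormP phi x; rewrite phi0 mul0r phix.
by rewrite (rnorm_real (c := 1))// ler10.
Qed.

End DensityDual.

(** * Cardinals *)

Section Cardinality.

Lemma card_le_injP T U (A : set T) (B : set U) :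
  (A #<= B)%card <-> exists f : A -> B, injective f.
Proof.
split=> [/card_leP[f]|[f fi]].
  by exists f => x y; apply: inj; rewrite in_setT.
by apply/card_leP/injfunPex; exists f => // x y _ _; exact: fi.
Qed.

Lemma card_le_inj T U (A : set T) (B : set U) (f : T -> U) :
  (forall x, A x -> B (f x)) -> {in A &, injective f} -> (A #<= B)%card.
Proof.
move=> fAB fi; rewrite -(card_le_eql (inj_card_eq fi)).
by apply: subset_card_le => _ [x Ax <-]; exact: fAB.
Qed.

(* A maximal set of functions that pairwise differ everywhere is mapped onto   *)
(* some [F i] by evaluation at [i].                                          *)
Lemma least_cardinal (I : Type) (F : I -> Type) : inhabited I ->
  exists i, forall j, exists f : F i -> F j, injective f.
Proof.
move=> [i0]; pose P := [set S : set (forall i, F i) |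
  forall f g i, S f -> S g -> f i = g i -> f = g].
have [G GP Gtot|S [PS Smax]] := @Zorn_bigcup _ P.
  move=> f g i [X GX Xf] [Y GY Yg] fg.
  have [XY|YX] := Gtot _ _ GX GY.
    by apply: (GP Y GY f g i) => //; exact: XY.
  by apply: (GP X GX f g i) => //; exact: YX.
(* Otherwise every [F i] has a point missed by [S], and these points form one more function, against
   maximality. *)
have [i iS] : exists i, forall x : F i, exists2 f, S f & f i = x.
  apply: contrapT => /forallNP h.
  have {}h i : {x : F i | forall f, S f -> f i <> x}.
    apply: cid; apply: contrapT => k; apply: (h i) => x.
    apply: contrapT => l; apply: k; exists x => f Sf fx; apply: l; by exists f.
  pose g i := sval (h i).
  have gS f i : S f -> f i <> g i by rewrite /g; case: (h i) => x hx /=; exact: hx.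
  apply: (Smax (S `|` [set g])).
    split=> [f Sf|]; first by left.
    by move=> /(_ g (or_intror erefl))/(gS g i0).
  move=> f f' j [Sf|->] [Sf'|->] //; first exact: PS.
    by move=> /(gS _ _ Sf).
  by move=> /esym/(gS _ _ Sf').
exists i => j; have {}iS x : {f | S f /\ f i = x}.
  by apply: cid; have [f] := iS x; exists f.
exists (fun x => sval (iS x) j) => x y; case: (iS x) => f [/= Sf <-].
by case: (iS y) => g [/= Sg <-] fg; rewrite (PS f g j).
Qed.

Lemma card_le_total T U :
  (exists f : T -> U, injective f) \/ (exists f : U -> T, injective f).
Proof.
have [b h] := @least_cardinal bool (fun b => if b then T else U) (inhabits true).
by case: b h => h; [left; exact: (h false)|right; exact: (h true)].
Qed.

(* Zorn's lemma on the graphs of injections [B * B -> B]: if [B] were smaller  *)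
(* than its complement, a copy of [B] there would allow an extension.        *)
Theorem hessenberg T (e : nat -> T) : injective e ->
  exists h : T * T -> T, injective h.
Proof.
(* A good [S] is the graph of an injection from B * B to B, where B is recovered as the set of [a]
   such that (a, a) has an image. *)
move=> ei; pose D (S : set ((T * T) * T)) a := exists c, S ((a, a), c).
pose good (S : set ((T * T) * T)) :=
  [/\ forall a b c, S ((a, b), c) -> [/\ D S a, D S b & D S c],
      forall a b, D S a -> D S b -> exists c, S ((a, b), c),
      forall p c c', S (p, c) -> S (p, c') -> c = c' &
      forall p p' c, S (p, c) -> S (p', c) -> p = p'].
(* The pairing of natural numbers, transported by [e]. It also puts into B the two distinct points
   [e 0] and [e 1], used later as tags. *)
pose S0 := [set ((e x.1, e x.2), e (pickle x)) | x in [set: nat * nat]].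
have S0D n : D S0 (e n) by exists (e (pickle (n, n))), (n, n).
have pickle_inj (x y : nat * nat) : pickle x = pickle y -> x = y.
  exact: (pcan_inj pickleK).
have [|||S [[S1 S2 S3 S4] S0S Smax]] := @Zorn_above _ good S0.
- split.
  + by move=> _ _ _ [x _ [<- <- <-]]; split; exact: S0D.
  + move=> a b [_ [[m m'] _ [<- _ _]]] [_ [[n n'] _ [<- _ _]]].
    by exists (e (pickle (m, n))), (m, n).
  + by move=> _ _ c [[x x'] _ [<- <-]] [[y y'] _ [/ei <- /ei <- <-]].
  + by move=> _ p c [x _ [<- <-]] [y _ [<- /ei/pickle_inj ->]].
- by exists ((e 0%N, e 0%N), e (pickle (0%N, 0%N))), (0%N, 0%N).
- move=> W _ two.
  have DW Z a : Z `<=` W -> D Z a -> D W a by move=> ZW [c Zc]; exists c; exact: ZW.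
  split.
  + move=> a b c Wp; have [Z [[Z1 _ _ _] ZW Zp _]] := two _ _ Wp Wp.
    by have [? ? ?] := Z1 _ _ _ Zp; split; exact: DW ZW _.
  + move=> a b [c Wc] [d Wd]; have [Z [[Z1 Z2 _ _] ZW Zc Zd]] := two _ _ Wc Wd.
    have [Da _ _] := Z1 _ _ _ Zc; have [Db _ _] := Z1 _ _ _ Zd.
    by have [x /ZW Wx] := Z2 _ _ Da Db; exists x.
  + move=> p c c' Wc Wc'; have [Z [[_ _ Z3 _] _ Zc Zc']] := two _ _ Wc Wc'.
    exact: Z3 Zc Zc'.
  + move=> p p' c Wc Wc'; have [Z [[_ _ _ Z4] _ Zc Zc']] := two _ _ Wc Wc'.
    exact: Z4 Zc Zc'.
pose B := D S.
have Be n : B (e n) by have [c /S0S Sc] := S0D n; exists c.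
have [h hP] : exists h : T -> T -> T, forall a b, B a -> B b -> S ((a, b), h a b).
  have /choice[h hP] : forall p : T * T, exists c, B p.1 -> B p.2 -> S (p, c).
    move=> [a b]; have [Ba|nBa] := pselect (B a); last by exists a.
    have [Bb|nBb] := pselect (B b); last by exists a.
    by have [c Sc] := S2 _ _ Ba Bb; exists c.
  by exists (fun a b => h (a, b)) => a b; exact: (hP (a, b)).
have hB a b : B a -> B b -> B (h a b).
  by move=> Ba Bb; have [] := S1 _ _ _ (hP _ _ Ba Bb).
have hi a b a' b' : B a -> B b -> B a' -> B b' -> h a b = h a' b' -> a = a' /\ b = b'.
  move=> Ba Bb Ba' Bb' hh; have := hP _ _ Ba Bb; rewrite hh => /S4 /(_ (hP _ _ Ba' Bb')).
  by move=> [].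
have eN : e 0%N <> e 1%N by move=> /ei.
have [[k ki]|[k ki]] := card_le_total {a | ~ B a} {a | B a}.
  (* If the complement of B embeds in B, tags embed all of T in B, and [h] then pairs the codes. *)
  pose code x := if pselect (B x) is right nB then h (e 1%N) (sval (k (exist _ x nB)))
    else h (e 0%N) x.
  have codeB x : B (code x).
    rewrite /code; case: pselect => // nB; apply: hB => //.
    by case: (k _).
  have codei : injective code.
    move=> x y; rewrite /code; case: pselect => [Bx|nBx]; case: pselect => [By|nBy].
    - by move=> /hi[].
    - case: (k _) => z Bz /= /hi[] //.
    - case: (k _) => z Bz /= /hi[] // /esym//.
    - case kx : (k _) => [z Bz]; case ky : (k _) => [t Bt] /= /hi[]// _ zt.
      have /ki[//] : k (exist _ x nBx) = k (exist _ y nBy).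
      by rewrite kx ky; exact/eq_exist.
  by exists (fun p => h (code p.1) (code p.2)) => -[x y] [x' y'] /= /hi[]// /codei -> /codei ->.
have [kk kkB kki] : exists2 kk : T -> T, (forall x, B x -> ~ B (kk x)) &
    forall x y, B x -> B y -> kk x = kk y -> x = y.
  exists (fun x => if pselect (B x) is left Bx then sval (k (exist _ x Bx)) else x).
    by move=> x Bx; case: pselect => // Bx'; case: (k _).
  move=> x y Bx By; case: pselect => // Bx'; case: pselect => // By'.
  move=> kxy; suff /ki[] : k (exist _ x Bx') = k (exist _ y By') by [].
  move: kxy; case: (k _) => a Pa; case: (k _) => b Pb /= ab; exact/eq_exist.
(* B together with its copy outside: [r] folds E back to B, [t] records the half, and [v] codes a
   pair of E by these four elements of B. *)
pose E x := B x \/ exists2 y, B y & x = kk y.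
have /choice[r rP] : forall x, exists y, E x ->
    B y /\ ((B x /\ y = x) \/ (~ B x /\ x = kk y)).
  move=> x; have [Bx|nBx] := pselect (B x); first by exists x; split=> //; left.
  have [[y By xy]|nC] := pselect (exists2 y, B y & x = kk y).
    by exists y; split=> //; right.
  by exists x => -[].
pose t x := if pselect (B x) then e 0%N else e 1%N.
have tB x : B (t x) by rewrite /t; case: pselect => ?; exact: Be.
pose v x y := h (h (r x) (r y)) (h (t x) (t y)).
have vB x y : E x -> E y -> B (v x y).
  by move=> /rP[Bx _] /rP[By _]; apply: (hB); apply: (hB) => //; exact: tB.
have rti x y : E x -> E y -> r x = r y -> t x = t y -> x = y.
  move=> /rP[_ rx] /rP[_ ry] rxy; rewrite /t.
  case: rx ry => [[Bx rx]|[nBx rx]] [[By ry]|[nBy ry]]; do 2 case: pselect => //.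
  - by rewrite -rx -ry.
  - by move=> _ _ /esym.
  - by rewrite rx ry rxy.
have vi x y x' y' : E x -> E y -> E x' -> E y' -> v x y = v x' y' -> x = x' /\ y = y'.
  move=> Ex Ey Ex' Ey'.
  have [[Bx _] [By _] [Bx' _] [By' _]] := And4 (rP _ Ex) (rP _ Ey) (rP _ Ex') (rP _ Ey').
  move=> /hi[]; do ?exact: hB.
  by move=> /hi[]// rx ry /hi[]// tx ty; split; exact: rti.
(* Pairs not in B * B are sent into the copy of B, hence never onto a value of [S]; the diagonal
   pair of kk (e 0) is new, against maximality. *)
pose G := [set q | S q \/ [/\ E q.1.1, E q.1.2, ~ (B q.1.1 /\ B q.1.2) &
  q.2 = kk (v q.1.1 q.1.2)]].
have ED x : E x <-> D G x.
  split=> [Ex|[c [Sc|[]//]]]; last by left; have [] := S1 _ _ _ Sc.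
  have [[c Sc]|nBx] := pselect (B x); first by exists c; left.
  by exists (kk (v x x)); right; split=> // -[].
suff gG : good G.
  have SG : S `<=` G by move=> p Sp; left.
  have Ek : E (kk (e 0%N)) by right; exists (e 0%N).
  have nk := kkB _ (Be 0%N).
  have : G ((kk (e 0%N), kk (e 0%N)), kk (v (kk (e 0%N)) (kk (e 0%N)))).
    by right; split=> // -[].
  by move=> /(Smax _ gG SG)/S1[].
split.
- move=> a b c [/S1[Ba Bb Bc]|[/= Ea Eb _ ->]]; split; apply/ED => //; try by left.
  by right; exists (v a b) => //; exact: vB.
- move=> a b /ED Ea /ED Eb; have [[Ba Bb]|nB] := pselect (B a /\ B b).
    by exists (h a b); left; exact: hP.
  by exists (kk (v a b)); right.
- move=> [a b] c c' [Sc|[/= Ea Eb nB ->]] [Sc'|[/= Ea' Eb' nB' ->]] //.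
  + exact: S3 Sc Sc'.
  + by have [Ba Bb _] := S1 _ _ _ Sc; exfalso; apply: nB'.
  + by have [Ba Bb _] := S1 _ _ _ Sc'; exfalso; apply: nB.
- move=> [a b] [a' b'] c [Sc|[/= Ea Eb nB ->]] [Sc'|[/= Ea' Eb' nB' cE]].
  + exact: S4 Sc Sc'.
  + have [_ _ Bc] := S1 _ _ _ Sc; exfalso.
    by apply: (kkB _ (vB _ _ Ea' Eb')); rewrite -cE.
  + have [_ _ Bc] := S1 _ _ _ Sc'; exfalso.
    exact: (kkB _ (vB _ _ Ea Eb)).
  + by have [-> ->] := vi _ _ _ _ Ea Eb Ea' Eb' (kki _ _ (vB _ _ Ea Eb) (vB _ _ Ea' Eb') cE).
Qed.

(** A list is folded into one element by the pairing. Its length is stored too, so that the final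
    [e 0] cannot be confused with a coded entry. *)
Lemma seq_injection (Q : countType) T (e : nat -> T) : injective e ->
  exists f : seq (Q * T) -> T, injective f.
Proof.
move=> ei; have [h hi] := hessenberg ei.
pose code (p : Q * T) := h (e (pickle p.1), p.2).
have codei : injective code.
  move=> [q x] [q' x'] /hi/= [/ei qq' ->]; congr pair.
  exact: (pcan_inj pickleK) qq'.
pose fold (s : seq (Q * T)) := foldr (fun p x => h (code p, x)) (e 0%N) s.
exists (fun s => h (e (size s), fold s)) => s s' /hi[/ei].
elim: s s' => [|p s IH] [|p' s']//= [ss'] /hi[/codei -> /IH -> //].
Qed.

Lemma min_dense_ex (T : topologicalType) : exists D : set T, min_dense D.
Proof.
have [|[D dD] Dmin] := @least_cardinal {D : set T | dense D} (fun D => sval D).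
  by split; exists setT; move=> O O0 _; rewrite setIT.
by exists D; split=> // E dE; apply/card_le_injP; exact: (Dmin (exist _ E dE)).
Qed.

End Cardinality.

(** * Density characters *)

Section DensityCharacter.
Context (R : realType).

Lemma countable_injection T (A : set T) : countable A -> exists g : A -> nat, injective g.
Proof.
move=> /card_le_injP[g gi]; exists (fun x => set_val (g x)) => x y /val_inj.
exact: gi.
Qed.

Lemma infinite_injection T (A : set T) : infinite_set A -> exists e : nat -> A, injective e.
Proof.
move=> /infiniteP/card_le_injP[e ei].
by exists (fun n => e (SigSub (mem_set (I : [set: nat] n)))) => m n /ei [].
Qed.

Lemma countable_rat_span (V : normedModType R[i]) (I : Type) (n : I -> V) (g : I -> nat) :
  injective g -> countable (rat_span n).
Proof.
move=> gi; apply: card_le_trans (card_image_le _ _) _.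
apply: (@card_le_inj _ _ _ _ (fun s => pickle [seq (p.1, g p.2) | p <- s])) => //.
move=> s t _ _ /(pcan_inj pickleK); apply: inj_map => -[q i] [r j] [-> /gi ->].
by [].
Qed.

Lemma card_rat_span (V : normedModType R[i]) (T : Type) (A : set T) (n : A -> V) :
  infinite_set A -> (rat_span n #<= A)%card.
Proof.
move=> /infinite_injection[e /(@seq_injection (rat * rat)%type)[f fi]].
apply: card_le_trans (card_image_le _ _) _.
apply: (@card_le_inj _ _ _ _ (fun s => set_val (f s))) => [s _|s t _ _ /val_inj/fi//].
exact/set_mem/valP.
Qed.

(** A finite dense set is closed, hence everything, but a nonzero x has infinitely many multiples n
    x. This settles the case in which lists outnumber elements. *)
Lemma finite_dense_trivial (V : normedModType R[i]) (D : set V) :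
  dense D -> finite_set D -> forall x : V, x = 0.
Proof.
move=> dD fD x; apply: contrapT => x0.
have DT : D = setT.
  apply: contrapT => DnT; have [||y []//] := dD (~` D).
    apply: contrapT => h; apply: DnT; apply/seteqP; split=> // y _.
    by apply: contrapT => Dy; apply: h; exists y.
  apply: closed_openC; apply: (proj1 accessible_finite_set_closed) => //.
  apply: hausdorff_accessible; exact: norm_hausdorff.
suff : infinite_set [set: V] by rewrite -DT.
apply/infiniteP; apply: (@card_le_inj _ _ _ _ (fun n => n%:R *: x)) => // m n _ _.
move=> /eqP; rewrite -subr_eq0 -scalerBl scaler_eq0 => /orP[|/eqP//].
by rewrite subr_eq0 eqr_nat => /eqP.
Qed.

Lemma card_le_trivial (V : normedModType R[i]) (D : set V) T (E : set T) :
  min_dense D -> (forall x : V, x = 0) -> E !=set0 -> (D #<= E)%card.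
Proof.
move=> [_ Dmin] V0 [t Et].
have : dense [set (0 : V)].
  by move=> O [x Ox] _; exists x; split=> //=.
move=> /Dmin/card_le_trans; apply.
by apply: (@card_le_inj _ _ _ _ (fun=> t)) => // x y; rewrite !inE => -> ->.
Qed.

Lemma dense_nonempty (T : topologicalType) (D : set T) (x : T) : dense D -> D !=set0.
Proof.
move=> dD; have [||y []] := dD setT; [by exists x|exact: openT|].
by move=> _ Dy; exists y.
Qed.

Variable X : normedModType R[i].
Hypothesis Xs : hahn_banach_smooth X.

Lemma smooth_dens_eq (Y : subsp X) : dens_eq (subsp_type Y) (dual (subsp_type Y)).
Proof.
have [D mD] := min_dense_ex (subsp_type Y).
have [E mE] := min_dense_ex (dual (subsp_type Y)).
exists D, E; split=> //; rewrite card_eq_le; apply/andP; split.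
  have [fE|iE] := pselect (finite_set E).
    apply: (card_le_trivial mD); last exact: (dense_nonempty 0 mE.1).
    move=> y; have [f _ fy] := norming_functional y.
    have f0 := finite_dense_trivial mE.1 fE f.
    by apply: rnorm_eq0; apply: complexI; rewrite -fy f0.
  have [y dy] := dense_of_dense_dual mE.1.
  exact: card_le_trans (mD.2 _ dy) (card_rat_span y iE).
have [fD|iD] := pselect (finite_set D).
  apply: (card_le_trivial mE); last exact: (dense_nonempty 0 mD.1).
  move=> f; apply: dualP => y.
  by rewrite (finite_dense_trivial mD.1 fD y) !linear0.
have [n dn] := dense_dual_of_dense Xs mD.1.
exact: card_le_trans (mE.2 _ dn) (card_rat_span n iD).
Qed.

Lemma smooth_separable_dual (Y : subsp X) :
  separable (subsp_type Y) -> separable (dual (subsp_type Y)).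
Proof.
move=> [D [cD dD]]; have [n dn] := dense_dual_of_dense Xs dD.
exists (rat_span n); split=> //.
by have [g gi] := countable_injection cD; exact: countable_rat_span gi.
Qed.

End DensityCharacter.

(** * Cluster points of bounded sequences of functionals *)

Section ClusterFunctional.
Context (R : realType) (X : normedModType R[i]).

(** Weak-* compactness along an ultrafilter, as a weak-* convergent subsequence may fail to exist.
    The limit of the real parts is real linear and bounded, so it complexifies; inequalities that
    hold eventually pass to it. *)
Lemma cluster_functional (u : nat -> dual X) (K : R) : 0 <= K ->
  (forall n, dnorm (u n) <= K) ->
  exists2 f : dual X, dnorm f <= K & forall x (a : R),
    (\forall n \near \oo, a <= complex.Re (u n x)) -> a <= complex.Re (f x).
Proof.
move=> K0 uK; have [U [UU ooU]] := @ultraFilterLemma nat \oo _.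
pose r x n : R := complex.Re (u n x).
have rK x n : r x n <= K * rnorm x.
  rewrite (le_trans (Re_le_rnorm _))// (le_trans (dnormP _ _))//.
  by rewrite ler_wpM2r ?rnorm_ge0.
have rlin (t : R) x y n : r (x + t%:C *: y) n = r x n + t * r y n.
  have -> : r (x + t%:C *: y) n = complex.Re (t%:C * u n y + u n x).
    by rewrite /r addrC linearP.
  by rewrite /r; case: (u n x) (u n y) => a b [c d] /=; ring.
have rN x n : r (- x) n = - r x n by rewrite /r !raddfN.
have lim_ex x : exists l : R, r x @ U --> l.
  have : (r x @ U) `[- (K * rnorm x), K * rnorm x]%classic.
    apply: (@filterE _ U) => n; rewrite /= in_itv; apply/andP; split; last exact: rK.
    have := rK (- x) n; rewrite rN.
    have -> : rnorm (- x) = rnorm x by rewrite /rnorm normrN.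
    by rewrite lerNl.
  move=> /(@segment_compact R)[l [_ lU]]; exists l => A lA.
  have [//|UA] := in_ultra_setVsetC (r x @^-1` A) UU.
  have [y [nAy Ay]] := lU (~` A) A UA lA.
  by [].
pose f x := sval (cid (lim_ex x)).
have rf x : r x @ U --> f x by rewrite /f; case: cid.
have flin (t : R) x y : f (x + t%:C *: y) = f x + t * f y.
  apply: (cvg_unique _ (rf (x + t%:C *: y))) => //.
  rewrite (_ : r _ = fun n => r x n + t * r y n); last by apply/funext => n; exact: rlin.
  by apply: cvgD; [exact: rf|apply: cvgMr; exact: rf].
have fK x : f x <= K * rnorm x.
  rewrite leNgt; apply/negP => Kf; have : \forall n \near U, K * rnorm x < r x n.
    by apply: cvgr_gt Kf; exact: rf.
  by move=> /filter_ex[n]; rewrite ltNge rK.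
have [F FK Ff] := complexification K0 fK flin; exists F => // x a /ooU ua.
rewrite Ff leNgt; apply/negP => fa; have : \forall n \near U, r x n < a.
  by apply: cvgr_lt fa; exact: rf.
by move=> /(filterI ua)/filter_ex[n [/=]]; rewrite leNgt => /negbTE ->.
Qed.

Lemma dnorm_le_Re (f : dual X) (c : R) : 0 <= c ->
  (forall x, complex.Re (f x) <= c * rnorm x) -> dnorm f <= c.
Proof.
move=> c0 fc; apply: dnorm_le => // x.
have [z z1 zf] := rotation (f x).
have -> : rnorm (f x) = complex.Re (f (z *: x)).
  by rewrite linearZ/= -[z *: f x]/(z * f x) zf.
by rewrite (le_trans (fc _))// rnormZ z1 mul1r.
Qed.

(** A bound on a norm amounts to real inequalities at each [x], so the bounds on u n - u m pass to a
    cluster functional in place of u m. *)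
Lemma dual_complete (u : nat -> dual X) (e : nat -> R) : (forall n, 0 <= e n) ->
  (forall m n, (m <= n)%N -> rnorm (u m - u n) <= e m) ->
  exists f, forall n, rnorm (u n - f) <= e n.
Proof.
move=> e0 ue; have uK n : dnorm (u n) <= dnorm (u 0%N) + e 0%N.
  have -> : u n = u 0%N - (u 0%N - u n) by rewrite subKr.
  rewrite -[leLHS]/(rnorm (u 0%N - (u 0%N - u n))) (le_trans (rnormD _ _))// lerD2l.
  have -> : rnorm (- (u 0%N - u n)) = rnorm (u 0%N - u n) by rewrite /rnorm normrN.
  exact: ue.
have K0 : 0 <= dnorm (u 0%N) + e 0%N by rewrite addr_ge0 ?dnorm_ge0.
have [f _ fu] := cluster_functional K0 uK; exists f => n.
apply: dnorm_le_Re => // x.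
rewrite -[(u n - f) x]/(u n x - f x) raddfB/= lerBlDr -lerBlDl.
apply: fu; exists n => // m /= nm; rewrite lerBlDl -lerBlDr -raddfB/=.
rewrite (le_trans (Re_le_rnorm _))//.
have -> : u n x - u m x = (u n - u m) x by [].
by rewrite (le_trans (dnormP _ _))// ler_wpM2r ?rnorm_ge0// ue.
Qed.

End ClusterFunctional.

(** * Vector measures *)

Section RnormLimits.
Context (R : realType).
Local Notation C := R[i]^o.

Lemma rnormN (V : normedModType R[i]) (x : V) : rnorm (- x) = rnorm x.
Proof. by rewrite /rnorm normrN. Qed.

Lemma rnormB (V : normedModType R[i]) (x y : V) : rnorm (x - y) = rnorm (y - x).
Proof. by rewrite -rnormN opprB. Qed.

Lemma rnorm_dist (V : normedModType R[i]) (x y : V) :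
  `|rnorm x - rnorm y| <= rnorm (x - y).
Proof.
have h (a b : V) : rnorm a - rnorm b <= rnorm (a - b).
  by rewrite lerBlDr (le_trans _ (rnormD _ _))// subrK.
by rewrite ler_norml h andbT lerNl opprB rnormB h.
Qed.

Lemma cvg_rnormP (V : normedModType R[i]) (u : nat -> V) (l : V) :
  u @ \oo --> l <->
  forall e : R, 0 < e -> \forall n \near \oo, rnorm (l - u n) < e.
Proof.
split=> [/cvgrPdist_lt h e e0|h].
  have {}h := h e%:C; have := h _; rewrite ltcR => /(_ e0).
  by apply: filterS => n; rewrite rnormE ltcR.
apply/cvgrPdist_lt => e e0.
have eE : e = (complex.Re e)%:C by rewrite RRe_real// gtr0_real.
have := h (complex.Re e); rewrite -ltcR -eE => /(_ e0).
by apply: filterS => n; rewrite rnormE {2}eE ltcR.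
Qed.

Lemma cvg_lipschitz (V W : normedModType R[i]) (L : V -> W) (c : R)
    (u : nat -> V) (l : V) : 0 <= c ->
  (forall x y, rnorm (L x - L y) <= c * rnorm (x - y)) ->
  u @ \oo --> l -> (fun n => L (u n)) @ \oo --> L l.
Proof.
move=> c0 Lc /cvg_rnormP ul; apply/cvg_rnormP => e e0.
have c1 : 0 < c + 1 by rewrite ltr_wpDl.
apply: filterS (ul _ (divr_gt0 e0 c1)) => n un.
rewrite (le_lt_trans (Lc _ _))//.
rewrite (@le_lt_trans _ _ ((c + 1) * rnorm (l - u n)))//.
  by rewrite ler_wpM2r ?rnorm_ge0// lerDl.
by rewrite mulrC -ltr_pdivlMr.
Qed.

Lemma cvg_rnorm_le (V : normedModType R[i]) (u : nat -> V) (l : V) (c : R) :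
  u @ \oo --> l -> (forall n, rnorm (u n) <= c) -> rnorm l <= c.
Proof.
move=> /cvg_rnormP ul uc; apply/ler_addgt0Pr => e e0.
have /filter_ex[n un] := ul e e0.
rewrite -[l](subrK (u n)) (le_trans (rnormD _ _))// addrC lerD//.
exact: ltW.
Qed.

Lemma cvg_Re_le (u : nat -> C) (l : C) (c : R) :
  u @ \oo --> l -> (forall n, complex.Re (u n) <= c) -> complex.Re l <= c.
Proof.
move=> /cvg_rnormP ul uc; apply/ler_addgt0Pr => e e0.
have /filter_ex[n un] := ul e e0.
rewrite -[l](subrK (u n)) raddfD/= addrC lerD//.
by rewrite (le_trans (Re_le_rnorm _))// ltW.
Qed.

End RnormLimits.

Section VectorMeasures.
Context (R : realType) (d : measure_display) (T : measurableType d).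
Context (mu : {finite_measure set T -> \bar R}).
Local Notation C := R[i]^o.
Local Notation m A := (fine (mu A)).

Lemma fine_measureK A : measurable A -> (m A)%:E = mu A.
Proof. by move=> mA; rewrite fineK// fin_num_measure. Qed.

Lemma fine_measure_ge0 A : 0 <= m A.
Proof. exact/fine_ge0/measure_ge0. Qed.

Lemma fine_measure_le A B : measurable A -> measurable B -> A `<=` B -> m A <= m B.
Proof.
by move=> mA mB AB; rewrite -lee_fin !fine_measureK// le_measure// inE.
Qed.

Lemma fine_measure_cvg (F : nat -> set T) : (forall n, measurable (F n)) ->
  trivIset setT F -> (\sum_(0 <= k < n) m (F k)) @[n --> \oo] --> m (\bigcup_n F n).
Proof.
move=> mF tF; have mU : measurable (\bigcup_n F n) by exact: bigcup_measurable.
have h : (\sum_(0 <= k < n) mu (F k))%E @[n --> \oo] --> (m (\bigcup_n F n))%:E.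
  by rewrite fine_measureK//; exact: measure_sigma_additive.
have <- : fine \o (fun n => \sum_(0 <= k < n) mu (F k))%E =
    fun n => \sum_(0 <= k < n) m (F k).
  apply/funext => n /=; under eq_bigr do rewrite -fine_measureK//.
  by rewrite sumEFin.
exact: fine_cvg h.
Qed.

Lemma fine_measure_sum_le (F : nat -> set T) A n : (forall n, measurable (F n)) ->
  trivIset setT F -> measurable A -> (forall k, F k `<=` A) ->
  \sum_(0 <= k < n) m (F k) <= m A.
Proof.
move=> mF tF mA FA.
apply: (@le_trans _ _ (m (\bigcup_n F n))); last first.
  by apply: fine_measure_le => //; [exact: bigcup_measurable|exact: bigcup_sub].
rewrite -(cvg_lim (@Rhausdorff R) (fine_measure_cvg mF tF)).
apply: nondecreasing_cvgn_le; last by apply: cvgP; exact: fine_measure_cvg.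
apply/nondecreasing_seqP => k; rewrite big_nat_recr//= lerDl.
exact: fine_measure_ge0.
Qed.

Lemma fine_measure0 : m (set0 : set T) = 0.
Proof. by rewrite measure0. Qed.

(* Greedy choice: the [n]-th set has at least half the largest mass still      *)
(* available.                                                                *)
Lemma exhaustion (P : set T -> Prop) (E : set T) : P set0 ->
  (forall A, P A -> measurable A) -> measurable E ->
  exists F : nat -> set T, [/\ forall n, P (F n), forall n, F n `<=` E,
    trivIset setT F &
    forall A, P A -> A `<=` E `\` \bigcup_n F n -> m A = 0].
Proof.
move=> P0 Pm mE.
have /choice[step stepP] : forall U : set T, exists A, [/\ P A, A `<=` U &
    forall B, P B -> B `<=` U -> m B <= 2 * m A].
  move=> U; pose S := [set m B | B in [set B | P B /\ B `<=` U]].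
  have Ssup : has_sup S.
    split; first by exists (m set0), set0 => //; split=> //; exact: sub0set.
    exists (m setT) => _ [B [PB _] <-].
    by apply: fine_measure_le => //; exact: Pm.
  have [S0|S0] := leP (sup S) 0.
    exists set0; split=> // B PB BU; rewrite fine_measure0 mulr0.
    by rewrite (le_trans _ S0)//; apply: ub_le_sup; [exact: Ssup.2|exists B].
  have /sup_adherent/(_ Ssup)[_ [A [PA AU] <-] SA] : 0 < sup S / 2.
    by rewrite divr_gt0.
  exists A; split=> // B PB BU.
  have : m B <= sup S by apply: ub_le_sup; [exact: Ssup.2|exists B].
  by move: SA; lra.
pose U := fix U n := if n is n'.+1 then U n' `\` step (U n') else E.
pose F n := step (U n).
have UE n : U n `<=` E by elim: n => //= n IH x [/IH].
have Umono k n : (k <= n)%N -> U n `<=` U k.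
  elim: n => [|n IH]; first by rewrite leqn0 => /eqP ->.
  by rewrite leq_eqVlt => /orP[/eqP ->//|/IH h] x [/h].
have FU n : F n `<=` U n by have [] := stepP (U n).
have PF n : P (F n) by have [] := stepP (U n).
have mF n : measurable (F n) by exact: Pm.
have disj k n x : (k < n)%N -> F k x -> F n x -> False.
  by move=> kn Fk /FU/(Umono _ _ kn)[_]; apply.
have tF : trivIset setT F.
  move=> k n _ _ [x [Fk Fn]]; apply/eqP; rewrite -[_ == _]negbK neq_ltn.
  by apply/negP => /orP[kn|nk]; [exact: (disj _ _ _ kn Fk Fn)|exact: (disj _ _ _ nk Fn Fk)].
exists F; split=> // [n|A PA AE]; first by move=> x /FU; exact: UE.
have AU n : A `<=` U n.
  move=> x /AE[Ex nF]; elim: n => //= n IH; split=> // Fx.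
  by apply: nF; exists n.
(* A set that avoids every [F n] was available at every stage. Were its mass positive, enough of the
   disjoint [F n] would exceed the mass of [E]. *)
have AF n : m A <= 2 * m (F n) by have [_ _] := stepP (U n); apply.
apply/eqP; rewrite eq_le fine_measure_ge0 andbT leNgt; apply/negP => A0.
have [n nA] : exists n : nat, 2 * m E / m A < n%:R.
  by exists (Num.truncn (2 * m E / m A)).+1; rewrite truncnS_gt.
have := fine_measure_sum_le n mF tF mE (fun k => subset_trans (@FU k) (@UE k)).
have : n%:R * m A <= 2 * \sum_(0 <= k < n) m (F k).
  rewrite mulr_sumr mulr_natl -[X in _ *+ X]subn0 -sumr_const_nat.
  by apply: ler_sum_nat => k _.
by move: nA; rewrite ltr_pdivrMr//; lra.
Qed.

Section VM.
Context (V : normedModType R[i]) (G : set T -> V).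
Hypothesis Gvm : vector_measure G.
Hypothesis G0 : G set0 = 0.

Lemma vector_measureU A B : measurable A -> measurable B -> [disjoint A & B] ->
  G (A `|` B) = G A + G B.
Proof.
move=> mA mB /disj_setPS AB.
have := Gvm (F := bigcup2 A B); rewrite bigcup2E => h.
have : \sum_(0 <= k < n) G (bigcup2 A B k) @[n --> \oo] --> G A + G B.
  apply: cvg_near_cst; exists 2%N => // n /= n2.
  rewrite big_ltn ?(ltnW n2)// big_ltn//= big_nat_cond big1 ?addr0//.
  by move=> [|[|k]]//= _; exact: G0.
move=> GAB; apply: (cvg_unique (@norm_hausdorff _ V) _ GAB).
apply: h; first by move=> [|[|k]] //=; exact: measurable0.
by rewrite -trivIset_bigcup2; apply/seteqP; split.
Qed.

Lemma vector_measureD A B : measurable A -> measurable B -> B `<=` A ->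
  G (A `\` B) = G A - G B.
Proof.
move=> mA mB BA; have := vector_measureU mB (measurableD mA mB).
rewrite setDUK// => ->; first by rewrite addrC addKr.
by apply/disj_setPS => x [Bx []].
Qed.

Lemma vector_measure_sum (I : choiceType) (s : seq I) (F : I -> set T) :
  (forall i, measurable (F i)) -> uniq s -> trivIset [set` s] F ->
  G (\big[setU/set0]_(i <- s) F i) = \sum_(i <- s) G (F i).
Proof.
move=> mF; elim: s => [|i s IH] /=; first by rewrite !big_nil.
move=> /andP[nis us] tF; rewrite !big_cons vector_measureU//; last 2 first.
- exact: bigsetU_measurable.
- apply/disj_setPS => x [Fi]; rewrite -bigcup_seq => -[j /= js Fj].
  have := tF i j; rewrite /= mem_head in_cons js orbT => /(_ isT isT).
  by move=> h; move: nis; rewrite h ?js//; exists x.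
rewrite IH//; apply: sub_trivIset tF => j /= js; by rewrite in_cons js orbT.
Qed.

Lemma vector_measure_shift (v : V) : vector_measure (fun A => G A - (m A)%:C *: v).
Proof.
move=> F mF tF; rewrite (_ : (fun n => _) =
    (fun n => \sum_(0 <= k < n) G (F k) - (\sum_(0 <= k < n) m (F k))%:C *: v)); last first.
  by apply/funext => n; rewrite sumrB rmorph_sum/= scaler_suml.
apply: cvgB; first exact: Gvm.
apply/cvg_rnormP => e e0.
have v1 : 0 < rnorm v + 1 by rewrite ltr_wpDl ?rnorm_ge0.
have /cvgrPdist_lt/(_ _ (divr_gt0 e0 v1)) := fine_measure_cvg mF tF.
apply: filterS => n un; rewrite -scalerBl -rmorphB/= rnormZ.
have -> : rnorm ((m (\bigcup_n F n) - \sum_(0 <= k < n) m (F k))%:C : C) =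
    `|m (\bigcup_n F n) - \sum_(0 <= k < n) m (F k)|.
  by rewrite /rnorm normc_def/= expr0n/= addr0 sqrtr_sqr.
set y := `|_| in un *.
rewrite (@le_lt_trans _ _ (y * (rnorm v + 1)))//.
  by rewrite ler_wpM2l ?normr_ge0// lerDl.
by rewrite -ltr_pdivlMr.
Qed.

Lemma vector_measure_comp (W : normedModType R[i]) (L : {linear V -> W}) (c : R) :
  0 <= c -> (forall x, rnorm (L x) <= c * rnorm x) ->
  vector_measure (fun A => L (G A)).
Proof.
move=> c0 Lc F mF tF; under eq_fun do rewrite -linear_sum.
apply: (@cvg_lipschitz _ _ _ L c) => // [x y|]; last exact: Gvm.
by rewrite -linearB; exact: Lc.
Qed.

End VM.

(** Half of a Hahn decomposition: exhausting the negative subsets of [A] only increases the real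
    part of the value, so the rest has positive mass, and its subsets of negative value would be
    null. *)
Lemma positive_subset (H : set T -> C) (A : set T) : vector_measure H ->
  abs_continuous mu H -> measurable A -> 0 < complex.Re (H A) ->
  exists F, [/\ measurable F, F `<=` A, 0 < m F &
    forall B, measurable B -> B `<=` F -> 0 <= complex.Re (H B)].
Proof.
move=> Hvm Hac mA HA.
have H0 : H set0 = 0 by apply: Hac => //; rewrite measure0.
(* Strictly negative or empty; [exhaustion] asks for the empty set. *)
pose P B := measurable B /\ complex.Re (H B) <= 0 /\ (complex.Re (H B) = 0 -> B = set0).
have [|B []//|//|F [PF FA tF Fmax]] := @exhaustion P A.
  by split=> //; rewrite H0.
have mF n : measurable (F n) by have [] := PF n.
have mU : measurable (\bigcup_n F n) by exact: bigcup_measurable.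
have UA : \bigcup_n F n `<=` A by exact: bigcup_sub.
have mD : measurable (A `\` \bigcup_n F n) by exact: measurableD.
have HU : complex.Re (H (\bigcup_n F n)) <= 0.
  apply: (cvg_Re_le (Hvm _ mF tF)) => n; rewrite raddf_sum/=.
  by rewrite sumr_le0// => k _; have [_ []] := PF k.
have neg B : measurable B -> m B = 0 -> H B = 0.
  by move=> mB B0; apply: Hac => //; rewrite -fine_measureK// B0.
exists (A `\` \bigcup_n F n); split=> //.
- rewrite lt_neqAle fine_measure_ge0 andbT eq_sym; apply/eqP => /(neg _ mD).
  by rewrite vector_measureD// => /(congr1 (@complex.Re R)); rewrite raddfB/=; lra.
- move=> B mB BD; rewrite leNgt; apply/negP => HB.
  have /neg HB0 : m B = 0.
    apply: Fmax => //; split=> //; split; first exact: ltW.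
    by move=> e; rewrite e ltxx in HB.
  by rewrite HB0//= ltxx in HB.
Qed.

(** Disjoint sets on which |G B| >= K m B have total mass at most M / K, and K = (M + 1) / m E makes
    this less than the mass of [E]. After exhaustion a set of positive mass remains, whose bad
    subsets are null. *)
Lemma lipschitz_subset (V : normedModType R[i]) (G : set T -> V) (E : set T) :
  bounded_variation_measure G -> abs_continuous mu G ->
  measurable E -> 0 < m E ->
  exists F (K : R), [/\ measurable F, F `<=` E, 0 < m F, 0 <= K &
    forall A, measurable A -> A `<=` F -> rnorm (G A) <= K * m A].
Proof.
move=> [M GM] Gac mE E0.
have G0 : G set0 = 0 by apply: Gac => //; rewrite measure0.
have M0 : 0 <= M.
  have := GM 0%N (fun=> set0) (fun=> measurable0).
  by rewrite big_ord0; apply => ? ?; rewrite !set0I => _ _ [].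
pose K := (M + 1) / m E.
have K0 : 0 < K by rewrite divr_gt0// ltr_wpDl.
pose P B := measurable B /\ K * m B <= rnorm (G B).
have [|B []//|//|F [PF FE tF Fmax]] := @exhaustion P E.
  by split=> //; rewrite fine_measure0 mulr0 rnorm_ge0.
have mF n : measurable (F n) by have [] := PF n.
have mU : measurable (\bigcup_n F n) by exact: bigcup_measurable.
have UE : \bigcup_n F n `<=` E by exact: bigcup_sub.
have mD : measurable (E `\` \bigcup_n F n) by exact: measurableD.
have KU : m (\bigcup_n F n) < m E.
  apply: (@le_lt_trans _ _ (M / K)); last first.
    rewrite ltr_pdivrMr// /K mulrCA mulfV ?gt_eqF// mulr1; lra.
  rewrite -(cvg_lim (@Rhausdorff R) (fine_measure_cvg mF tF)).
  apply: limr_le; first by apply: cvgP; exact: fine_measure_cvg.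
  apply: nearW => n; rewrite ler_pdivlMr// mulr_suml.
  apply: (le_trans _ (GM n (fun k => F k) _ _)) => //; last first.
    by move=> i j _ _ ij; apply/val_inj; exact: tF.
  rewrite big_mkord; apply: ler_sum => k _.
  by rewrite mulrC; have [] := PF k.
exists (E `\` \bigcup_n F n), K; split=> //.
- rewrite measureD// ?setIidr ?fineB ?fin_num_measure// ?subr_gt0//.
  by rewrite -ge0_fin_numE ?measure_ge0// fin_num_measure.
- exact: ltW.
- move=> A mA AD; rewrite leNgt; apply/negP => GA.
  have A0 : m A = 0 by apply: Fmax => //; split=> //; exact: ltW.
  by move: GA; rewrite Gac ?rnorm0 ?A0 ?mulr0 ?ltxx// -fine_measureK// A0.
Qed.

End VectorMeasures.

(** * Small oscillation *)

Section SmallOscillation.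
Context (R : realType) (d : measure_display) (T : measurableType d).
Context (mu : {finite_measure set T -> \bar R}).
Local Notation C := R[i]^o.
Local Notation m A := (fine (mu A)).
Variables (X : normedModType R[i]) (G : set T -> dual X).
Hypotheses (Gvm : vector_measure G) (Gac : abs_continuous mu G).

Lemma half_slice (x : X) (A : set T) (q : R) : measurable A ->
  m A * q < complex.Re (G A x) ->
  exists F, [/\ measurable F, F `<=` A, 0 < m F &
    forall B, measurable B -> B `<=` F -> m B * q <= complex.Re (G B x)].
Proof.
move=> mA qA; pose H B : C := canon x (G B) - (m B)%:C *: (q%:C : C).
have HE B : complex.Re (H B) = complex.Re (G B x) - m B * q.
  transitivity (complex.Re (G B x) - complex.Re ((m B)%:C * q%:C)).
    exact: raddfB.
  by rewrite -rmorphM.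
have Hvm : vector_measure H.
  apply: vector_measure_shift.
  apply: (@vector_measure_comp _ _ _ _ _ Gvm _ (canon x) (dnorm (canon x)));
    first exact: dnorm_ge0.
  exact: dnormP.
have Hac : abs_continuous mu H.
  move=> B mB B0; have -> : H B = canon x 0 - 0%:C *: (q%:C : C).
    by rewrite /H Gac// B0.
  by rewrite scale0r subr0 linear0.
have [|F [mF FA F0 HF]] := positive_subset Hvm Hac mA.
  by rewrite HE subr_gt0.
exists F; split=> // B mB BF.
by rewrite -subr_ge0 -HE HF.
Qed.

(** Some [x] in the unit ball gives averages a over [A] and b over [F] with a - b > e. Around the
    midpoint [c], [half_slice] yields a piece of [A] above c + e/4 (b = true, sign +) and one of [F]
    below c - e/4 (b = false, sign -). *)
Lemma slice_split (F A : set T) (e : R) : 0 < e -> measurable F -> 0 < m F ->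
  measurable A -> A `<=` F -> e * m A < rnorm (G A - (m A / m F)%:C *: G F) ->
  exists (x : X) (c : R) (L : bool -> set T), rnorm x <= 1 /\
    forall b, [/\ measurable (L b), L b `<=` F, 0 < m (L b) &
      forall B, measurable B -> B `<=` L b ->
        m B * ((-1) ^+ (~~ b) * c + e / 4) <= (-1) ^+ (~~ b) * complex.Re (G B x)].
Proof.
move=> e0 mF F0 mA AF.
have [A0|A0] := eqVneq (m A) 0.
  by rewrite Gac ?A0 ?mul0r ?scale0r ?subr0 ?rnorm0 ?mulr0 ?ltxx// -fine_measureK// A0.
have {}A0 : 0 < m A by rewrite lt_neqAle eq_sym A0 fine_measure_ge0.
set g := G A - _; move=> /sup_gt[|_ [x0 /= x01 <-]].
  exact: (dnorm_has_sup _).1.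
have [z z1 zg] := rotation (g x0).
pose x := z *: x0; pose a := complex.Re (G A x) / m A; pose b := complex.Re (G F x) / m F.
have aE : m A * a = complex.Re (G A x) by rewrite mulrC divfK// gt_eqF.
have bE : m F * b = complex.Re (G F x) by rewrite mulrC divfK// gt_eqF.
have -> : rnorm (g x0) = m A * (a - b).
  have -> : rnorm (g x0) = complex.Re (g x).
    by rewrite linearZ/= -[z *: g x0]/(z * g x0) zg.
  rewrite mulrBr aE /b mulrCA mulrC -[(g x)]/(G A x - (m A / m F)%:C * G F x).
  rewrite raddfB/=; congr (_ - _).
  by case: (G F x) => p q /=; ring.
rewrite mulrC ltr_pM2l// => ab; pose c := (a + b) / 2.
have [L [mL LA L0 LB]] : exists L, [/\ measurable L, L `<=` A, 0 < m L &
    forall B, measurable B -> B `<=` L -> m B * (c + e / 4) <= complex.Re (G B x)].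
  by apply: half_slice => //; rewrite -aE ltr_pM2l// /c; lra.
have [L' [mL' LA' L0' LB']] : exists L, [/\ measurable L, L `<=` F, 0 < m L &
    forall B, measurable B -> B `<=` L -> m B * (- c + e / 4) <= complex.Re (G B (- x))].
  apply: half_slice => //; rewrite raddfN raddfN/= -bE -[ltRHS]mulrN ltr_pM2l// /c; lra.
exists x, c, (fun b => if b then L else L'); split; first by rewrite rnormZ z1 mul1r.
case; split=> //.
- exact: subset_trans AF.
- by move=> B mB BL; rewrite expr0 !mul1r LB.
- by move=> B mB BL; rewrite expr1 !mulN1r; have := LB' _ mB BL; rewrite !raddfN.
Qed.

Hypothesis Gbv : bounded_variation_measure G.
Hypothesis Xsep : forall Y : subsp X,
  separable (subsp_type Y) -> separable (dual (subsp_type Y)).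

(* Otherwise every piece of [E] splits into two pieces whose averages are      *)
(* separated by some [x s], giving a dyadic tree. Let [Y] be spanned by the   *)
(* [x s] and let [phi k] be dense in [dual Y]: choosing at the [k]-th node    *)
(* the side away from [phi k], a cluster point of the averages along the      *)
(* branch stays at distance [e / 4] from every [phi k].                       *)
Lemma small_oscillation (E : set T) (e : R) : 0 < e -> measurable E -> 0 < m E ->
  exists F (v : dual X), [/\ measurable F, F `<=` E, 0 < m F &
    forall A, measurable A -> A `<=` F -> rnorm (G A - (m A)%:C *: v) <= e * m A].
Proof.
move=> e0 mE0 E0; apply: contrapT => noF.
(* On subsets of [E'] the averages of [G] are bounded by [K], so they have a cluster point along
   every branch. *)
have [E' [K [mE' E'E E'0 K0 GK]]] := lipschitz_subset Gbv Gac mE0 E0.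
pose N := {F | [/\ measurable F, F `<=` E' & 0 < m F]}.
have /choice[step stepP] : forall F : N, exists q : X * R * (bool -> N),
    rnorm q.1.1 <= 1 /\ forall b, sval (q.2 b) `<=` sval F /\
      forall B, measurable B -> B `<=` sval (q.2 b) ->
        m B * ((-1) ^+ (~~ b) * q.1.2 + e / 4) <= (-1) ^+ (~~ b) * complex.Re (G B q.1.1).
  move=> [F [mF FE F0]].
  have [A [mA AF GA]] : exists A, [/\ measurable A, A `<=` F &
      e * m A < rnorm (G A - (m A / m F)%:C *: G F)].
    (* The constant tried on [F] is the average of [G] over [F]. *)
    apply: contrapT => noA; apply: noF; exists F, ((m F)^-1%:C *: G F); split=> //.
      exact: subset_trans E'E.
    move=> A mA AF; rewrite scalerA -rmorphM leNgt; apply/negP => GA.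
    by apply: noA; exists A.
  have [x [c [L [x1 LP]]]] := slice_split e0 mF F0 mA AF GA.
  have LN b : [/\ measurable (L b), L b `<=` E' & 0 < m (L b)].
    by have [? LF ? _] := LP b; split=> //; exact: subset_trans FE.
  exists (x, c, fun b => exist _ (L b) (LN b)); split=> // b /=.
  by have [] := LP b.
pose x F := (step F).1.1; pose c F := (step F).1.2; pose child F b := (step F).2 b.
pose node := fix node (s : seq bool) : N :=
  if s is b :: s' then child (node s') b else exist _ E' (And3 mE' (@subset_refl _ E') E'0).
pose xs s := x (node s).
pose Y := Subsp (lin_span_subspace xs).
have xY s : xs s \in subsp_pred Y by apply/asboolP; exact: lin_span_mem.
pose y s : subsp_type Y := SubspElt (xY s).
have sepY : separable (subsp_type Y).
  exists (rat_span y); split.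
    exact: (countable_rat_span (g := pickle) _ (pcan_inj pickleK)).
  apply: rat_span_dense; apply/denseP => w r r0; exists w; last by rewrite subrr rnorm0.
  case: w => w wY; have /asboolP[s ws] := wY; exists s; apply: val_inj => /=.
  rewrite ws; elim: s {ws} => [|p s IH]; first by rewrite !big_nil.
  by rewrite !big_cons IH.
have [D [cD dD]] := Xsep sepY.
have [g gi] := countable_injection cD.
have /choice[phi phiP] : forall k, exists f : dual (subsp_type Y),
    forall h : D, g h = k -> f = set_val h.
  move=> k; have [[h gh]|nh] := pselect (exists h, g h = k).
    by exists (set_val h) => h' gh'; congr set_val; apply: gi; rewrite gh gh'.
  by exists 0 => h gh; exfalso; apply: nh; exists h.
(* Lists grow at the head. The upper child is taken when phi k is at most [c] at the current node,
   the lower one otherwise. *)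
pose path := fix path k : seq bool := if k is k'.+1 then
  (complex.Re (phi k' (y (path k'))) <= c (node (path k'))) :: path k' else [::].
pose F k := sval (node (path k)).
have mF k : measurable (F k) by rewrite /F; case: (node _) => ? [].
have FE k : F k `<=` E' by rewrite /F; case: (node _) => ? [].
have F0 k : 0 < m (F k) by rewrite /F; case: (node _) => ? [].
have Fmono k j : (k <= j)%N -> F j `<=` F k.
  elim: j => [|j IH]; first by rewrite leqn0 => /eqP ->.
  rewrite leq_eqVlt => /orP[/eqP ->//|/IH h]; apply: subset_trans h.
  exact: ((stepP (node (path j))).2 _).1.
pose u k : dual X := (m (F k))^-1%:C *: G (F k).
have uE k w : complex.Re (u k w) = complex.Re (G (F k) w) / m (F k).
  rewrite -[u k w]/((m (F k))^-1%:C * G (F k) w).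
  by case: (G (F k) w) => p q /=; ring.
have uK k : dnorm (u k) <= K.
  rewrite -[dnorm _]/(rnorm (u k)) rnormZ rnorm_real ?invr_ge0 ?fine_measure_ge0//.
  by rewrite mulrC ler_pdivrMr// GK.
have [f _ fu] := cluster_functional K0 uK.
have [k fphi] : exists k, rnorm (restrict Y f - phi k) < e / 4.
  move/denseP : dD => /(_ (restrict Y f) _ (divr_gt0 e0 (ltr0Sn _ 3)))[h Dh fh].
  by exists (g (SigSub (mem_set Dh))); rewrite (phiP _ _ erefl).
set w := xs (path k).
pose b := complex.Re (phi k (y (path k))) <= c (node (path k)).
(* From index k + 1 on, the branch stays in the child chosen at node [k], so [f] inherits its margin
   e/4 over [c], while phi k lies on the other side of [c]. *)
have key : (-1) ^+ (~~ b) * c (node (path k)) + e / 4 <= complex.Re (f ((-1) ^+ (~~ b) *: w)).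
  apply: fu; exists k.+1 => // j /= kj; rewrite uE ler_pdivlMr// mulrC.
  have := (stepP (node (path k))).2 b; rewrite -/(c _) -/(x _) => -[_].
  move=> /(_ (F j) (mF j) (@Fmono k.+1 j kj))/le_trans; apply.
  by rewrite /w /xs; case: (b); rewrite ?expr0 ?scale1r ?mul1r// expr1 scaleN1r mulN1r !raddfN.
have : complex.Re ((-1) ^+ (~~ b) * (restrict Y f - phi k) (y (path k))) <=
    rnorm (restrict Y f - phi k).
  rewrite (le_trans (Re_le_rnorm _))// rnormM.
  have -> : rnorm ((-1) ^+ (~~ b) : C) = 1.
    by rewrite /rnorm; case: (~~ b); rewrite ?expr0 ?expr1 ?normrN normr1.
  rewrite mul1r (le_trans (dnormP _ _))// ler_piMr ?dnorm_ge0//.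
  exact: (stepP _).1.
rewrite -[(restrict Y f - phi k) _]/(f w - phi k (y (path k))).
have : if b then complex.Re (phi k (y (path k))) <= c (node (path k))
    else c (node (path k)) < complex.Re (phi k (y (path k))) by rewrite /b; case: leP.
move: key; case: (b) => /=; rewrite ?expr0 ?expr1 ?scale1r ?scaleN1r ?mul1r ?mulN1r.
  by rewrite raddfB/=; lra.
by rewrite !raddfN/= raddfB/=; lra.
Qed.

End SmallOscillation.

(** * Partitions approximating a density *)

Section Partition.
Context (R : realType) (d : measure_display) (T : measurableType d).
Context (mu : {finite_measure set T -> \bar R}).
Local Notation m A := (fine (mu A)).
Variables (V : normedModType R[i]) (G : set T -> V).

(** On a cell of level n one constant is within 1/(n+1) both of [g] at each point and of all
    averages of [G] over non-null subsets. *)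
Record derivative_approx (Z : set T) (Q : nat -> nat -> set T)
    (v : nat -> nat -> V) (g : T -> V) : Prop := DerivativeApprox {
  approx_measurableZ : measurable Z ;
  approx_null : mu Z = 0%E ;
  approx_measurable : forall n k, measurable (Q n k) ;
  approx_disjoint : forall n, trivIset setT (Q n) ;
  approx_cover : forall n, \bigcup_k Q n k = ~` Z ;
  approx_zero : forall t, Z t -> g t = 0 ;
  approx_value : forall n k t, Q n k t -> rnorm (v n k - g t) <= n.+1%:R^-1 ;
  approx_average : forall n k A, measurable A -> A `<=` Q n k ->
    rnorm (G A - (m A)%:C *: v n k) <= n.+1%:R^-1 * m A }.

Lemma null_bigcup (N : nat -> set T) :
  (forall n, measurable (N n) /\ mu (N n) = 0%E) ->
  measurable (\bigcup_n N n) /\ mu (\bigcup_n N n) = 0%E.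
Proof.
move=> h; have mN : measurable (\bigcup_n N n).
  by apply: bigcupT_measurable => n; exact: (h n).1.
split=> //; apply/negligibleP => //; apply: negligible_bigcup => n.
by apply/negligibleP; [exact: (h n).1|exact: (h n).2].
Qed.

(** Two cells that share positive mass have close constants, as both approximate [G] on the
    intersection. With null intersections moved into [Z], the constants met at any other point form
    a Cauchy sequence, whose limit is [g]. *)
Lemma derivative_approx_ex :
  (forall E e, 0 < e -> measurable E -> 0 < m E ->
    exists F (v : V), [/\ measurable F, F `<=` E, 0 < m F &
      forall A, measurable A -> A `<=` F -> rnorm (G A - (m A)%:C *: v) <= e * m A]) ->
  (forall (u : nat -> V) (e : nat -> R), (forall n, 0 <= e n) ->
    (forall m n, (m <= n)%N -> rnorm (u m - u n) <= e m) ->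
    exists l, forall n, rnorm (u n - l) <= e n) ->
  abs_continuous mu G ->
  exists Z Q v g, derivative_approx Z Q v g.
Proof.
(* Half of 1/(n+1): comparing the constants of two overlapping cells costs an error from each
   level. *)
move=> osc Vcomp Gac; pose e n : R := n.+1%:R^-1 / 2.
have e0 n : 0 < e n by rewrite divr_gt0// invr_gt0.
pose good n F v := forall A, measurable A -> A `<=` F ->
  rnorm (G A - (m A)%:C *: v) <= e n * m A.
pose P n F := measurable F /\ exists v, good n F v.
have /choice[F FP] : forall n, exists F : nat -> set T, [/\ forall k, P n (F k),
    trivIset setT F & mu (~` \bigcup_k F k) = 0%E].
  move=> n; have [|A []//|//|F [PF _ tF Fmax]] := @exhaustion _ _ _ mu (P n) setT.
    split=> //; exists 0 => A mA; rewrite subset0 => ->.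
    by rewrite Gac// scaler0 subr0 rnorm0 mulr_ge0 ?fine_measure_ge0// ltW.
  exists F; split=> //.
  have mD : measurable (~` \bigcup_k F k).
    by apply: measurableC; apply: bigcupT_measurable => k; have [] := PF k.
  rewrite -fine_measureK//; congr (_%:E); apply/eqP.
  rewrite eq_le fine_measure_ge0 andbT leNgt; apply/negP => D0.
  have [A [v [mA AD A0 Av]]] := osc _ _ (e0 n) mD D0.
  have A00 : m A = 0 by apply: Fmax; [split=> //; exists v|rewrite setTD].
  by rewrite A00 ltxx in A0.
have mF n k : measurable (F n k) by have [/(_ k)[]] := FP n.
have /choice[v vP] : forall p : nat * nat, exists w, good p.1 (F p.1 p.2) w.
  by move=> [n k]; have [/(_ k)[]] := FP n.
pose Zp n k n' k' := if m (F n k `&` F n' k') == 0 then F n k `&` F n' k' else set0.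
pose Z := \bigcup_n (~` (\bigcup_k F n k) `|`
  \bigcup_k \bigcup_n' \bigcup_k' Zp n k n' k').
have [mZ Z0] : measurable Z /\ mu Z = 0%E.
  apply: null_bigcup => n.
  have [m1 n1] : measurable (\bigcup_k \bigcup_n' \bigcup_k' Zp n k n' k') /\
      mu (\bigcup_k \bigcup_n' \bigcup_k' Zp n k n' k') = 0%E.
    apply: null_bigcup => k; apply: null_bigcup => n'; apply: null_bigcup => k'.
    rewrite /Zp; case: ifPn => [/eqP h|_]; last by split.
    have mI : measurable (F n k `&` F n' k') by exact: measurableI.
    by split=> //; rewrite -fine_measureK ?h.
  have m2 : measurable (~` (\bigcup_k F n k)).
    by apply: measurableC; exact: bigcupT_measurable.
  split; first exact: measurableU.
  by rewrite null_set_setU//; have [] := FP n.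
pose Q n k := F n k `\` Z.
have tQ n : trivIset setT (Q n).
  have [_ tF _] := FP n; move=> k l _ _ [t [[Fk _] [Fl _]]].
  by apply: tF => //; exists t.
have cover n : \bigcup_k Q n k = ~` Z.
  apply/seteqP; split=> [t [k _ []]//|t Zt].
  apply: contrapT => nQ; apply: (Zt); exists n => //; left => -[k _ Fk].
  by apply: nQ; exists k.
have close t n k n' k' : (n <= n')%N -> Q n k t -> Q n' k' t ->
    rnorm (v (n, k) - v (n', k')) <= n.+1%:R^-1.
  move=> nn' [Fk Zt] [Fk' _]; pose A := F n k `&` F n' k'.
  have mA : measurable A by exact: measurableI.
  have A0 : 0 < m A.
    rewrite lt_neqAle fine_measure_ge0 andbT eq_sym; apply/negP => /eqP A0.
    apply: Zt; exists n => //; right; exists k => //; exists n' => //; exists k' => //.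
    by rewrite /Zp A0 eqxx.
  have h1 := vP (n, k) A mA (@subIsetl _ _ _).
  have h2 := vP (n', k') A mA (@subIsetr _ _ _).
  rewrite /= in h1 h2.
  have e' : e n' <= e n.
    by rewrite ler_pM2r ?invr_gt0// lef_pV2 ?posrE// ler_nat.
  have : m A * rnorm (v (n, k) - v (n', k')) <= (e n + e n') * m A.
    rewrite -{1}[m A]rnorm_real ?fine_measure_ge0// -rnormZ mulrDl.
    rewrite scalerBr -(subrKA (G A)) (le_trans (rnormD _ _))// lerD//.
    by rewrite rnormB.
  rewrite mulrC ler_pM2r// => /le_trans; apply.
  by rewrite (le_trans (lerD (lexx _) e'))// -splitr.
have /choice[g gP] : forall t, exists l : V, (Z t -> l = 0) /\
    forall n k, Q n k t -> rnorm (v (n, k) - l) <= n.+1%:R^-1.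
  move=> t; have [Zt|nZt] := pselect (Z t).
    by exists 0; split=> // n k [].
  have /choice[k kP] : forall n, exists k, Q n k t.
    by move=> n; have [k _ Qk] : (\bigcup_k Q n k) t; [rewrite cover|exists k].
  have [||l lP] := Vcomp (fun n => v (n, k n)) (fun n => n.+1%:R^-1).
  - by move=> n; rewrite invr_ge0.
  - by move=> n n' nn'; exact: close nn' (kP n) (kP n').
  exists l; split=> // n k' Qk'.
  by rewrite -(tQ n (k n) k' Logic.I Logic.I) ?lP//; exists t.
exists Z, Q, (fun n k => v (n, k)), g; split=> //.
- by move=> n k; exact: measurableD.
- by move=> t Zt; exact: (gP t).1.
- by move=> n k t; exact: (gP t).2.
- move=> n k A mA AQ; rewrite (le_trans (vP (n, k) A mA _))//.
    by move=> t /AQ[].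
  rewrite ler_wpM2r ?fine_measure_ge0// /e ler_pdivrMr// ler_peMr ?invr_ge0//.
  by rewrite ler1n.
Qed.

End Partition.

(** * Bochner integrability of the density *)

Section SimpleFunctions.
Context (R : realType) (d : measure_display) (T : measurableType d).
Variable V : normedModType R[i].
Implicit Types s : T -> V.

Lemma vsimple_cst (v : V) : vsimple (fun _ : T => v).
Proof.
split; first exact: finite_image_cst.
move=> w; have [->|vw] := pselect (v = w).
  by rewrite (_ : _ @^-1` _ = setT)//; apply/seteqP; split.
by rewrite (_ : _ @^-1` _ = set0)//; apply/seteqP; split=> // t /= /vw.
Qed.

Lemma vsimple_if (s : T -> V) (A : set T) (v : V) : vsimple s -> measurable A ->
  vsimple (fun t => if t \in A then v else s t).
Proof.
move=> [fs ms] mA; split.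
  apply: (@sub_finite_set _ _ (range s `|` [set v])).
    by move=> _ [t _ <-]; case: ifP => _; [right|left; exists t].
  by rewrite finite_setU; split=> //; exact: finite_set1.
move=> w; rewrite (_ : _ @^-1` _ =
    (A `&` (fun _ => v) @^-1` [set w]) `|` (~` A `&` s @^-1` [set w])).
  apply: measurableU; apply: measurableI => //; last exact: measurableC.
  exact: (vsimple_cst v).2.
apply/seteqP; split=> t /=.
  by case: ifPn => [/set_mem At|/negP At] <-; [left|right; split=> // /mem_set].
by move=> [[At <-]|[At <-]]; [rewrite mem_set|rewrite memNset].
Qed.

Lemma vsimple_measurable2 (s1 s2 : T -> V) (phi : V -> V -> R) :
  vsimple s1 -> vsimple s2 -> measurable_fun setT (fun t => phi (s1 t) (s2 t)).
Proof.
move=> [f1 m1] [f2 m2] _ Y mY; rewrite setTI.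
rewrite (_ : _ @^-1` _ = \bigcup_(p in (range s1 `*` range s2) `&` [set p | Y (phi p.1 p.2)])
    (s1 @^-1` [set p.1] `&` s2 @^-1` [set p.2])).
  apply: fin_bigcup_measurable => [|p _]; last exact: measurableI.
  by apply: finite_setIl; exact: finite_setX.
apply/seteqP; split=> [t Yt|t [[a b] [_ Yab] [/= ea eb]]]; last by rewrite /= ea eb.
by exists (s1 t, s2 t) => //; split=> //; split; exists t.
Qed.

Fixpoint refine (Q : nat -> set T) (v : nat -> V) n (s : T -> V) : T -> V :=
  if n is n'.+1 then fun t => if t \in Q n' then v n' else refine Q v n' s t else s.

Lemma refine_vsimple Q v n s : (forall k, measurable (Q k)) -> vsimple s ->
  vsimple (refine Q v n s).
Proof. by move=> mQ vs; elim: n => //= n IH; exact: vsimple_if. Qed.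

Lemma refineP Q v n s t :
  (exists k, [/\ (k < n)%N, Q k t & refine Q v n s t = v k]) \/
  ((forall k, (k < n)%N -> ~ Q k t) /\ refine Q v n s t = s t).
Proof.
elim: n => [|n IH] /=; first by right.
case: ifPn => [/set_mem Qt|/negP Qt]; first by left; exists n.
case: IH => [[k [kn Qk e]]|[nQ e]]; first by left; exists k; rewrite ltnS ltnW.
right; split=> // k; rewrite ltnS leq_eqVlt => /orP[/eqP -> /mem_set//|].
exact: nQ.
Qed.

(* The value [v j k] on [Q j k] for the largest admissible [j]. *)
Fixpoint approximant (Q : nat -> nat -> set T) (v : nat -> nat -> V) n j : T -> V :=
  if j is j'.+1 then refine (Q j') (v j') n (approximant Q v n j') else fun=> 0.

Lemma approximant_vsimple Q v n j : (forall i k, measurable (Q i k)) ->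
  vsimple (approximant Q v n j).
Proof.
move=> mQ; elim: j => [|j IH] /=; first exact: vsimple_cst.
exact: refine_vsimple.
Qed.

Lemma approximant_value Q v n j t :
  approximant Q v n j t = 0 \/
  exists i k, Q i k t /\ approximant Q v n j t = v i k.
Proof.
elim: j => [|j IH] /=; first by left.
have [[k [_ Qk ->]]|[_ ->//]] := refineP (Q j) (v j) n (approximant Q v n j) t.
by right; exists j, k.
Qed.

Lemma approximant_index Q v n j i k t : (i < j)%N -> (k < n)%N -> Q i k t ->
  exists i' k', [/\ (i <= i')%N, Q i' k' t & approximant Q v n j t = v i' k'].
Proof.
move=> ij kn Qik; elim: j ij => // j IH; rewrite ltnS => ij /=.
have [[l [_ Ql ->]]|[nQ ->]] := refineP (Q j) (v j) n (approximant Q v n j) t.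
  by exists j, l.
apply: IH; rewrite ltn_neqAle ij andbT; apply/eqP => e.
by apply: (nQ k kn); rewrite -e.
Qed.

End SimpleFunctions.

(** * The vector measure as the indefinite integral of its density *)

Section Derivative.
Context (R : realType) (d : measure_display) (T : measurableType d).
Context (mu : {finite_measure set T -> \bar R}).
Local Notation m A := (fine (mu A)).
Variables (V : normedModType R[i]) (G : set T -> V).
Hypotheses (Gvm : vector_measure G) (Gac : abs_continuous mu G).
Variables (Z : set T) (Q : nat -> nat -> set T) (v : nat -> nat -> V) (g : T -> V).
Hypothesis GQ : derivative_approx mu G Z Q v g.

Let mZ : measurable Z := approx_measurableZ GQ.
Let mQ n k : measurable (Q n k) := approx_measurable GQ n k.
Let s n := approximant Q v n n.

Let G0 : G set0 = 0. Proof. by apply: Gac => //; rewrite measure0. Qed.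

Let in_cover t n : ~ Z t -> exists k, Q n k t.
Proof.
by move=> Zt; have [k _ Qk] : (\bigcup_k Q n k) t; [rewrite (approx_cover GQ)|exists k].
Qed.

Let notZ n k t : Q n k t -> ~ Z t.
Proof. by move=> Qt; rewrite -[~ _]/((~` Z) t) -(approx_cover GQ n); exists k. Qed.

(** A point of [Q i k] receives from [s n], once n exceeds i and k, a constant of level at least i,
    hence within 1/(i+1) of [g]. On [Z] everything is 0. *)
Lemma approximant_cvg t : s n t @[n --> \oo] --> g t.
Proof.
have [Zt|nZt] := pselect (Z t).
  apply: cvg_near_cst; apply: nearW => n; rewrite (approx_zero GQ Zt) /s.
  by have [//|[i [k [/notZ]]]] := approximant_value Q v n n t.
apply/cvg_rnormP => e e0.
have [i ie] : exists i : nat, i.+1%:R^-1 < e.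
  exists (Num.truncn e^-1); rewrite -[ltRHS]invrK ltf_pV2 ?posrE ?invr_gt0//.
  exact: truncnS_gt.
have [k Qik] := in_cover i nZt.
exists (maxn i k).+1 => // n /=; rewrite gtn_max => /andP[ik kn].
rewrite /s; have [i' [k' [ii' Qt ->]]] := approximant_index v ik kn Qik.
rewrite rnormB (le_lt_trans (approx_value GQ Qt))// (le_lt_trans _ ie)//.
by rewrite lef_pV2 ?posrE// ler_nat.
Qed.

Lemma approximant_dominated n t : rnorm (g t - s n t) <= rnorm (g t) + 1.
Proof.
rewrite /s; have [->|[i [k [Qt ->]]]] := approximant_value Q v n n t.
  by rewrite subr0 lerDl.
rewrite rnormB (le_trans (approx_value GQ Qt))// (@le_trans _ _ 1)//.
  by rewrite invf_le1// ler1n.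
by rewrite lerDr rnorm_ge0.
Qed.

(** Only real functions are measured, as V has no measurable structure here: this one is a pointwise
    limit of functions of two simple maps. *)
Lemma measurable_rnormB (w : T -> V) : vsimple w ->
  measurable_fun setT (fun t => rnorm (g t - w t)).
Proof.
move=> vw; apply: (@measurable_fun_cvg _ _ _ _ (fun n t => rnorm (s n t - w t))).
  move=> n; apply: (vsimple_measurable2 (fun a b => rnorm (a - b))) => //.
  exact: approximant_vsimple.
move=> t _; apply/cvgrPdist_lt => e e0.
have /cvg_rnormP/(_ e e0) := @approximant_cvg t.
apply: filterS => n; apply: le_lt_trans.
rewrite (le_trans (rnorm_dist _ _))//.
by rewrite opprB addrA subrK.
Qed.

Let measurable_int (w : T -> V) A : vsimple w -> measurable A ->
  measurable_fun A (fun t => (rnorm (g t - w t))%:E).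
Proof.
move=> vw mA; apply/measurable_EFinP; apply: measurable_funS (measurable_rnormB vw) => //.
Qed.

Lemma sum_integral_le (f : T -> \bar R) (F : nat -> set T) A N :
  measurable_fun setT f -> (forall t, 0 <= f t)%E ->
  (forall k, measurable (F k)) -> trivIset setT F -> measurable A ->
  (forall k, F k `<=` A) ->
  (\sum_(0 <= k < N) \int[mu]_(t in F k) f t <= \int[mu]_(t in A) f t)%E.
Proof.
move=> mf f0 mF tF mA FA.
rewrite /index_iota subn0 -ge0_integral_bigsetU//; last 3 first.
- exact: iota_uniq.
- exact: sub_trivIset tF.
- exact: measurable_funS mf.
apply: ge0_subset_integral => //.
- exact: bigsetU_measurable.
- exact: measurable_funS mf.
- by rewrite -bigcup_seq; apply: bigcup_sub => k _; exact: FA.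
Qed.

(** One error 1/(n+1) comes from replacing [G B] by m B times v n k, the other from replacing v n k
    by [g]. *)
Lemma piece_le n k B w : measurable B -> B `<=` Q n k ->
  ((rnorm (G B - (m B)%:C *: w))%:E <=
   \int[mu]_(t in B) (rnorm (g t - w))%:E + (2 * n.+1%:R^-1 * m B)%:E)%E.
Proof.
move=> mB BQ; pose r := rnorm (v n k - w).
have h1 : rnorm (G B - (m B)%:C *: w) <= n.+1%:R^-1 * m B + r * m B.
  rewrite -(subrKA ((m B)%:C *: v n k)) (le_trans (rnormD _ _))// lerD//.
    exact: (approx_average GQ).
  by rewrite -scalerBr rnormZ rnorm_real ?fine_measure_ge0// mulrC.
have h2 : ((r * m B)%:E <=
    \int[mu]_(t in B) (rnorm (g t - w))%:E + (n.+1%:R^-1 * m B)%:E)%E.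
  rewrite !EFinM fine_measureK// -!integral_cst// -ge0_integralD//=; last 2 first.
  - by move=> t _; rewrite lee_fin rnorm_ge0.
  - exact: (measurable_int (vsimple_cst _ w) mB).
  apply: ge0_le_integral => //=.
  - by move=> t _; rewrite lee_fin rnorm_ge0.
  - by apply: emeasurable_funD => //; exact: (measurable_int (vsimple_cst _ w) mB).
  move=> t Bt; rewrite -EFinD lee_fin /r -(subrKA (g t)) (le_trans (rnormD _ _))//.
  by rewrite addrC lerD2l (approx_value GQ)//; exact: BQ.
rewrite (@le_trans _ _ ((n.+1%:R^-1 * m B)%:E + (r * m B)%:E)%E)//.
rewrite (le_trans (leeD2l _ h2))// addeCA -EFinD.
by rewrite leeD2l// lee_fin -mulrDl mulr_natl.
Qed.

(** [piece_le] is summed over the cells of a single level n, which cover [A] up to a null set; the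
    errors add up to at most 2 m A / (n+1). *)
Lemma constant_le A w : measurable A ->
  ((rnorm (G A - (m A)%:C *: w))%:E <= \int[mu]_(t in A) (rnorm (g t - w))%:E)%E.
Proof.
move=> mA; pose rho B := G B - (m B)%:C *: w.
have rho_vm : vector_measure rho by exact: vector_measure_shift.
have rho0 B : measurable B -> mu B = 0%E -> rho B = 0.
  by move=> mB B0; rewrite /rho Gac// B0 scale0r subr0.
rewrite -/(rho A).
have I0 : (0 <= \int[mu]_(t in A) (rnorm (g t - w))%:E)%E.
  by apply: integral_ge0 => t _; rewrite lee_fin rnorm_ge0.
have [->|If] := eqVneq (\int[mu]_(t in A) (rnorm (g t - w))%:E)%E +oo%E; first exact: leey.
have {}If : (\int[mu]_(t in A) (rnorm (g t - w))%:E)%E \is a fin_num.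
  by rewrite ge0_fin_numE// ltey.
apply/lee_addgt0Pr => e e0.
have A1 : 0 < 2 * m A + 1 by rewrite ltr_wpDl// mulr_ge0 ?fine_measure_ge0.
have [n ne] : exists n : nat, n.+1%:R^-1 * (2 * m A + 1) <= e.
  exists (Num.truncn (e / (2 * m A + 1))^-1).
  rewrite -ler_pdivlMr// -[leRHS]invrK lef_pV2 ?posrE ?invr_gt0 ?divr_gt0//.
  by rewrite ltW// truncnS_gt.
rewrite -(fineK If) -EFinD lee_fin.
have -> : rho A = rho (\bigcup_k (A `&` Q n k)).
  rewrite -setI_bigcupr (approx_cover GQ) -setDE.
  rewrite -{1}(setUIDK A Z) setUC vector_measureU//; last 4 first.
  - by apply: rho0 => //; rewrite measure0.
  - exact: measurableD.
  - exact: measurableI.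
  - by apply/disj_setPS => t [[_ ?] []].
  rewrite (rho0 (A `&` Z)) ?addr0//; first exact: measurableI.
  by apply: subset_measure0 (approx_null GQ) => //; exact: measurableI.
have mAQ k : measurable (A `&` Q n k) by exact: measurableI.
have tAQ : trivIset setT (fun k => A `&` Q n k) by exact/trivIset_setIl/(approx_disjoint GQ).
apply: (cvg_rnorm_le (rho_vm _ mAQ tAQ)) => N.
rewrite (le_trans (rnorm_sum _ _ _))// -lee_fin -sumEFin.
rewrite (@le_trans _ _ (\sum_(0 <= k < N) (\int[mu]_(t in A `&` Q n k) (rnorm (g t - w))%:E
    + (2 * n.+1%:R^-1 * m (A `&` Q n k))%:E))%E)//.
  by apply: lee_sum => k _; apply: (@piece_le n k) => //; exact: subIsetr.
rewrite big_split/= EFinD leeD// ?fineK//.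
  apply: sum_integral_le => //; [exact: (measurable_int (vsimple_cst _ w) measurableT)|].
  by move=> t; rewrite lee_fin rnorm_ge0.
rewrite sumEFin lee_fin -mulr_sumr (le_trans _ ne)//.
rewrite mulrAC mulrC ler_wpM2l ?invr_ge0//.
have := fine_measure_sum_le mu N mAQ tAQ mA (fun k => @subIsetl _ _ _).
lra.
Qed.

(** The bridge to the Bochner integral: simple functions that approach [g] in mean have integrals
    approaching [G E]. It is [constant_le] summed over the level sets of [w]. *)
Lemma simple_le E (w : T -> V) : measurable E -> vsimple w ->
  ((rnorm (G E - vsimple_integral mu w E))%:E <=
   \int[mu]_(t in E) (rnorm (g t - w t))%:E)%E.
Proof.
move=> mE vw; have [fw mw] := vw.
pose A x := E `&` w @^-1` [set x]; pose l := finmap.enum_fset (fset_set (range w)).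
have mA x : measurable (A x) by exact: measurableI.
have tA : trivIset [set` l] A by move=> x y _ _ [t [[_ <-] [_ <-]]].
have EA : E = \big[setU/set0]_(x <- l) A x.
  rewrite -bigcup_seq; apply/seteqP; split=> [t Et|t [x _ []]//].
  by exists (w t) => //=; rewrite in_fset_set// inE; exists t.
have ul : uniq l by exact: finmap.fset_uniq.
have -> : vsimple_integral mu w E = \sum_(x <- l) (m (A x))%:C *: x.
  by rewrite /vsimple_integral fsbig_finite.
rewrite [G E](_ : _ = \sum_(x <- l) G (A x)); last first.
  by rewrite {1}EA vector_measure_sum.
rewrite -sumrB [in leRHS]EA ge0_integral_bigsetU//; last 2 first.
- by rewrite -EA; exact: measurable_int.
- by move=> t _; rewrite lee_fin rnorm_ge0.
rewrite (@le_trans _ _ (\sum_(x <- l) rnorm (G (A x) - (m (A x))%:C *: x))%:E)//.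
  by rewrite lee_fin rnorm_sum.
rewrite -sumEFin; apply: lee_sum => x _.
rewrite (le_trans (constant_le x (mA x)))// le_eqVlt; apply/orP; left; apply/eqP.
by apply: eq_integral => t; rewrite inE => -[_ /= ->].
Qed.

Hypothesis Gbv : bounded_variation_measure G.

(** Level 0, with error 1, suffices: the integral over [Q 0 k] is at most |G (Q 0 k)| + 2 m (Q 0 k),
    and bounded variation controls the sum of the first terms. *)
Lemma integrable_rnorm : mu.-integrable setT (fun t => (rnorm (g t))%:E).
Proof.
have mg A : measurable A -> measurable_fun A (fun t => (rnorm (g t))%:E).
  move=> mA; have := measurable_int (vsimple_cst _ 0) mA.
  by under eq_fun do rewrite subr0.
apply/integrableP; split; first exact: mg.
under eq_integral do rewrite gee0_abs ?lee_fin ?rnorm_ge0//.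
have [M GM] := Gbv.
have -> : [set: T] = Z `|` \bigcup_k Q 0 k by rewrite (approx_cover GQ) setUv.
have mU : measurable (\bigcup_k Q 0 k) by exact: bigcupT_measurable.
rewrite ge0_integral_setU//; last 3 first.
- by apply: mg; exact: measurableU.
- by move=> t _; rewrite lee_fin rnorm_ge0.
- by rewrite (approx_cover GQ); apply/disj_setPS => t [].
rewrite (@integral0_eq _ _ _ mu Z) ?add0e; last first.
  by move=> t Zt; rewrite (approx_zero GQ Zt) rnorm0.
rewrite ge0_integral_bigcup//; last 3 first.
- exact: mg.
- by move=> t _; rewrite lee_fin rnorm_ge0.
- exact: (approx_disjoint GQ).
apply: (@le_lt_trans _ _ (M + 2 * m setT)%:E); last exact: ltry.
apply: lime_le.
  by apply: is_cvg_nneseries => k _ _; apply: integral_ge0 => t _; rewrite lee_fin rnorm_ge0.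
apply: nearW => N.
have piece k : (\int[mu]_(t in Q 0 k) (rnorm (g t))%:E <=
    (rnorm (G (Q 0 k)) + 2 * m (Q 0 k))%:E)%E.
  rewrite (@le_trans _ _ (\int[mu]_(t in Q 0 k) cst (rnorm (v 0 k) + 1)%:E t)%E)//.
    apply: ge0_le_integral => //.
    - by move=> t _; rewrite lee_fin rnorm_ge0.
    - exact: mg.
    move=> t Qt; rewrite lee_fin -[g t](subrK (v 0 k)) (le_trans (rnormD _ _))//.
    rewrite addrC lerD2l rnormB (le_trans (approx_value GQ Qt))//.
    by rewrite invr1.
  have -> : (\int[mu]_(t in Q 0 k) cst (rnorm (v 0 k) + 1)%:E t)%E =
      ((rnorm (v 0 k) + 1) * m (Q 0 k))%:E.
    by rewrite integral_cst// EFinM fine_measureK.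
  rewrite lee_fin.
  have := approx_average GQ (mQ 0 k) (@subset_refl _ (Q 0 k)).
  rewrite invr1 mul1r => h.
  have : rnorm ((m (Q 0 k))%:C *: v 0 k) <=
      rnorm (G (Q 0 k)) + rnorm (G (Q 0 k) - (m (Q 0 k))%:C *: v 0 k).
    by rewrite rnormB -{1}[_ *: _](subrK (G (Q 0 k))) (le_trans (rnormD _ _))// addrC.
  rewrite rnormZ rnorm_real ?fine_measure_ge0//; lra.
rewrite (le_trans (lee_sum _ (fun k _ => piece k)))// sumEFin lee_fin.
rewrite big_split/= lerD//.
  rewrite big_mkord; apply: (GM N (fun k => Q 0 k)) => //.
  by move=> i j _ _ ij; apply/val_inj; exact: (@approx_disjoint _ _ _ _ _ _ _ _ _ _ GQ 0).
rewrite -mulr_sumr ler_wpM2l//.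
by apply: fine_measure_sum_le => //; exact: (approx_disjoint GQ).
Qed.

Lemma derivative_bochner E : measurable E -> bochner_integral mu g E (G E).
Proof.
move=> mE; have vs n : vsimple (s n) by exact: approximant_vsimple.
split; first by exists s; split=> //; apply: aeW => t; exact: approximant_cvg.
have dom : (\int[mu]_(t in E) (rnorm (g t - s n t))%:E)%E @[n --> \oo] --> 0%E.
  have := @dominated_convergence _ _ _ mu E mE
    (fun n t => (rnorm (g t - s n t))%:E) (fun=> 0%E) (fun t => (rnorm (g t) + 1)%:E).
  case=> //.
  - by move=> n; exact: measurable_int.
  - apply: aeW => t _; apply/fine_cvgP; split; first exact: nearW.
    apply/cvgrPdist_lt => e e0; have /cvg_rnormP/(_ e e0) := @approximant_cvg t.
    by apply: filterS => n; rewrite sub0r normrN ger0_norm ?rnorm_ge0.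
  - apply: (integrableS measurableT) => //.
    under eq_fun do rewrite EFinD.
    apply: integrableD => //; first exact: integrable_rnorm.
    by apply/integrableP; split=> //; rewrite integral_cst// lte_mul_pinfty//
      ltey_eq fin_num_measure.
  - apply: aeW => t n _; rewrite gee0_abs ?lee_fin ?rnorm_ge0//.
    exact: approximant_dominated.
  move=> _ _; rewrite integral0; exact.
exists s; split=> //; apply/cvg_rnormP => e e0.
have /fine_cvgP[fin /cvgrPdist_lt/(_ e e0)] := dom.
apply: filterS2 fin => n fin; rewrite sub0r normrN; apply: le_lt_trans.
rewrite -lee_fin (le_trans (simple_le mE (vs n)))//.
by rewrite ger0_norm ?fineK// fine_ge0// integral_ge0// => t _; rewrite lee_fin rnorm_ge0.
Qed.

End Derivative.

Theorem theorem2p10 (R : realType) (X : completeOperatorSpaceType R)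
    (Xnonreflexive : ~ reflexive_space X) (Xemb : right_M_embedded X) :
  [/\ forall Y : subsp X, closed (subsp_set Y) ->
        dens_eq (subsp_type Y) (dual (subsp_type Y)),
      forall Y : subsp X,
        separable (subsp_type Y) -> separable (dual (subsp_type Y)),
      asplund X &
      radon_nikodym_property (dual X)].
Proof.
have Xs := M_embedded_smooth Xemb.
have Xsep := smooth_separable_dual Xs.
split=> [Y _|//|//|d T mu G Gvm Gbv Gac]; first exact: smooth_dens_eq.
have osc := small_oscillation Gvm Gac Gbv Xsep.
have [Z [Q [v [g GQ]]]] :=
  derivative_approx_ex (fun E e e0 => osc E e e0) (@dual_complete R X) Gac.
by exists g => E; exact: derivative_bochner GQ Gbv E.
Qed.
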